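(* Let $T>0$, let $(U,d_U)$ be a compact metric space, and let $f:\mathbb{R}^d\times U\to\mathbb{R}^d$ satisfy: (i) $f$ is continuous and there exists $m>0$ such that $|f(x,u)|\le m(1+|x|)$ for all $(x,u)\in\mathbb{R}^d\times U$; (ii) for each compact set $K\subset\mathbb{R}^d$ there exists $\ell_K>0$ such that $|f(x,u)-f(y,u)|\le \ell_K|x-y|$ for all $x,y\in K$ and $u\in U$. Let $\mathcal{L}$ and $\mathcal{P}_{(\tau,t)}$ be the associated set-valued Liouville and Perron-Frobenius operators, and let $\tau\in[0,T]$. Then, the inclusions $$\{-\mathrm{div}_x(f_u\mu)~:~u\in U\}\subset\operatorname*{Liminf}_{t\to\tau}\frac{\mathcal{P}_{(\tau,t)}(\mu)-\mu}{t-\tau}$$ and $$\operatorname*{Limsup}_{t\to\tau}\frac{\mathcal{P}_{(\tau,t)}(\mu)-\mu}{t-\tau}\subset\overline{\mathrm{co}}\,\{-\mathrm{div}_x(f_u\mu)~:~u\in U\}$$ are satisfied for each $\mu\in\mathcal{X}^*$. Furthermore, if the set of controlled vector fields $\mathcal{F}:=\{f_u\in C^0(\mathbb{R}^d,\mathbb{R}^d)~:~u\in U\}$ is convex, then the adjoint of the set-valued Liouville operator is the infinitesimal generator of the Perron-Frobenius semigroup, in the sense that $$\operatorname*{Lim}_{t\to\tau}\frac{\mathcal{P}_{(\tau,t)}(\mu)-\mu}{t-\tau}=\mathcal{L}^*(\mu)$$ for all $\mu\in\mathcal{X}^*$, with the limit being taken in the weak-$^*$ topology.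
   Context: For $u\in U$, $f_u:=f(\cdot,u)$. $\mathcal{X}:=C^0_c(\mathbb{R}^d,\mathbb{C})$ is the separable normed space of continuous complex-valued functions with compact support, endowed with the supremum norm, and $\mathcal{D}:=C^1_c(\mathbb{R}^d,\mathbb{C})$ is the separable normed space of continuously differentiable complex-valued functions with compact support, endowed with the corresponding $C^1$ supremum norm. For a locally convex topological vector space $\mathcal{E}$, $\mathcal{E}^*$ is its topological dual (the bounded complex-valued linear functionals on $\mathcal{E}$), with duality pairing $\langle\cdot,\cdot\rangle_{\mathcal{E}}$; dual spaces are endowed with the weak-$^*$ topology, and the Kuratowski-Painlevé limits and closed convex hulls of the statement are taken in this topology. One has $\mathcal{X}^*\simeq\mathcal{M}(\mathbb{R}^d,\mathbb{C})$, the space of finite complex-valued Radon measures; these are regarded as elements of $\mathcal{D}^*$ by restriction. For $\mu\in\mathcal{M}(\mathbb{R}^d,\mathbb{C})$ and $g\in C^0(\mathbb{R}^d,\mathbb{R}^d)$, the divergence distribution $\mathrm{div}_x(g\mu)\in\mathcal{D}^*$ is defined by $\langle\mathrm{div}_x(g\mu),\zeta\rangle_{\mathcal{D}}:=-\int_{\mathbb{R}^d}\nabla_x\zeta(x)\cdot g(x)\,d\mu(x)$ for all $\zeta\in\mathcal{D}$. $\mathcal{U}$ is the set of Lebesgue-measurable maps $u:[0,T]\to U$. For $u(\cdot)\in\mathcal{U}$, the controlled flow $(\Phi^u_{(\tau,t)})_{\tau,t\in[0,T]}\subset C^0(\mathbb{R}^d,\mathbb{R}^d)$ is the unique solution of $\Phi^u_{(\tau,t)}(x)=x+\int_\tau^t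 f(\Phi^u_{(\tau,s)}(x),u(s))\,ds$ for all $\tau,t\in[0,T]$, $x\in\mathbb{R}^d$. The Perron-Frobenius operators are $\mathcal{P}_{(\tau,t)}(\mu):=\{\Phi^u_{(\tau,t)\sharp}\mu~:~u(\cdot)\in\mathcal{U}\}\subset\mathcal{X}^*$ for $\mu\in\mathcal{X}^*$, where $g_\sharp\mu(B):=\mu(g^{-1}(B))$ for Borel sets $B\subset\mathbb{R}^d$. The Liouville operator $\mathcal{L}:\mathcal{D}\rightrightarrows\mathcal{X}$ is $\mathcal{L}(\varphi):=\{\nabla_x\varphi\cdot f_u~:~u\in U\}$. Adjoint: given two locally convex topological vector spaces $\mathcal{E},\mathcal{Y}$, the adjoint $F^*:\mathcal{Y}^*\rightrightarrows\mathcal{E}^*$ of a closed process $F:\mathcal{E}\rightrightarrows\mathcal{Y}$ (a set-valued map whose graph is a closed cone) is $F^*(\mu):=\{\nu\in\mathcal{E}^*~:~\langle\nu,x\rangle_{\mathcal{E}}\le\sup_{y\in F(x)}\langle\mu,y\rangle_{\mathcal{Y}}~\text{ for all }x\in\mathcal{E}\}$; $\mathcal{L}^*:\mathcal{X}^*\rightrightarrows\mathcal{D}^*$ is given by this formula with $\mathcal{E}=\mathcal{D}$, $\mathcal{Y}=\mathcal{X}$. Kuratowski-Painlevé limits in the weak-$^*$ topology, for a family of sets $(K_t)$ with $t\in[0,T]\setminus\{\tau\}$, are understood via neighbourhoods: $\nu\in\operatorname{Liminf}_{t\to\tau}K_t$ if for every weak-$^*$ neighbourhood $N$ of $\nu$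 there is $\delta>0$ such that $K_t\cap N\ne\emptyset$ whenever $0<|t-\tau|<\delta$; $\nu\in\operatorname{Limsup}_{t\to\tau}K_t$ if for every weak-$^*$ neighbourhood $N$ of $\nu$ and every $\delta>0$ there is $t$ with $0<|t-\tau|<\delta$ and $K_t\cap N\neq\emptyset$; $\operatorname{Lim}_{t\to\tau}K_t$ is their common value when they coincide.
   Formalization: D* is taken as the functionals bounded in C^1 norm on functions supported in each fixed compact set (not the dual of the normed space D, which need not contain div_x(f_u mu)), and the complex inequality defining the adjoint L* is read on real parts. *)

(* Defs.v *)
From HB Require Import structures.
From mathcomp Require Import all_boot all_order all_algebra.
From mathcomp Require Import complex.
From mathcomp Require Import all_classical all_reals all_analysis.
From mathcomp Require Import measurable_realfun ring.

Set Implicit Arguments.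
Unset Strict Implicit.
Unset Printing Implicit Defensive.

Import Order.TTheory GRing.Theory Num.Theory.
Import numFieldNormedType.Exports.
Import ComplexField.

Local Open Scope classical_set_scope.
Local Open Scope ring_scope.
Local Open Scope complex_scope.

Local Notation Re := (@complex.Re _).
Local Notation Im := (@complex.Im _).

Section Spaces.
Context {R : realType} {d : nat}.
Local Notation V := 'rV[R]_d.
Implicit Types (z : V -> R[i]) (j : 'I_d).

(* The norm `|x| of the library on row vectors is the maximum norm. *)
Definition enorm (x : V) : R := Num.sqrt (\sum_j x 0 j ^+ 2).

Definition compact_support z := compact (closure [set x | z x != 0]).

(* Complex partial derivative, taken on the real and imaginary parts; e_j is
   the row vector delta_mx 0 j. *)
Definition partial j z (x : V) : R[i] :=
  ('D_(delta_mx 0 j) (Re \o z : V -> R) x) +i*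
  ('D_(delta_mx 0 j) (Im \o z : V -> R) x).

Definition is_C0c z := continuous (z : V -> R[i]^o) /\ compact_support z.

Definition is_C1c z :=
  [/\ forall x, differentiable (Re \o z : V -> R) x,
      forall x, differentiable (Im \o z : V -> R) x,
      forall j, continuous (partial j z : V -> R[i]^o)
    & compact_support z].

Definition C0c_pred : {pred V -> R[i]} := [pred z | `[< is_C0c z >]].
Definition C1c_pred : {pred V -> R[i]} := [pred z | `[< is_C1c z >]].

Lemma C0cP z : reflect (is_C0c z) (z \in C0c_pred).
Proof. by rewrite inE; exact: asboolP. Qed.

Lemma C1cP z : reflect (is_C1c z) (z \in C1c_pred).
Proof. by rewrite inE; exact: asboolP. Qed.

Lemma compact_support_sub z1 z2 : (forall x, z2 x = 0 -> z1 x = 0) ->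
  compact_support z2 -> compact_support z1.
Proof.
move=> z21 cz2; apply: subclosed_compact cz2 _; first exact: closed_closure.
apply: closureS => x /=; apply: contraNN => /eqP z2x.
by rewrite z21.
Qed.

Lemma compact_supportD (a : R[i]) z1 z2 : compact_support z1 ->
  compact_support z2 -> compact_support (a *: z1 + z2).
Proof.
move=> c1 c2; rewrite /compact_support.
apply: (subclosed_compact _ (compactU c1 c2)); first exact: closed_closure.
rewrite -closureU; apply: closureS => x /= h.
rewrite !fctE in h.
have [z10|z10] := eqVneq (z1 x) 0; last by left.
right; apply: contraNneq h => z20.
by rewrite z10 z20 addr0 scaler0.
Qed.

Lemma compact_support0 : compact_support 0.
Proof.
rewrite /compact_support (_ : [set x | _] = set0) ?closure0; first exact: compact0.
by apply/seteqP; split => x //=; rewrite eqxx.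
Qed.

Lemma continuous_ReIm z : continuous (z : V -> R[i]^o) ->
  continuous (Re \o z : V -> R) /\ continuous (Im \o z : V -> R).
Proof.
have H (g : R[i] -> R) : (forall u v, g (u - v) = g u - g v) ->
   (forall u, `|g u| <= Normc.normc u) -> continuous (z : V -> R[i]^o) ->
   continuous (g \o z : V -> R).
  move=> gB gn cz x; apply/(@cvgrPdist_lt _ _ _ (nbhs x)) => e e0.
  have e0' : (0 : R[i]) < e%:C by rewrite ltcR.
  have czx := (@cvgrPdist_lt _ _ _ (nbhs x) _ (z : V -> R[i]^o) (z x)).1 (cz x) _ e0'.
  near=> y; rewrite /= -gB.
  have h : `|z x - z y| < e%:C by near: y; exact: czx.
  rewrite (le_lt_trans (gn _))// -ltcR.
  by rewrite normc_def in h; case: (z x - z y) h.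
move=> cz; split; apply: H => //.
- by move=> [? ?] [? ?].
- by move=> [a b]; rewrite /= -sqrtr_sqr ler_wsqrtr// lerDl sqr_ge0.
- by move=> [? ?] [? ?].
- by move=> [a b]; rewrite /= -sqrtr_sqr ler_wsqrtr// lerDr sqr_ge0.
Unshelve. all: by end_near. Qed.

Lemma differentiable_lin3 (a b : R) (g1 g2 g3 : V -> R) (x : V) :
  differentiable g1 x -> differentiable g2 x -> differentiable g3 x ->
  differentiable (fun y => a * g1 y + b * g2 y + g3 y) x /\
  forall v, 'D_v (fun y => a * g1 y + b * g2 y + g3 y) x =
    a * 'D_v g1 x + b * 'D_v g2 x + 'D_v g3 x.
Proof.
move=> d1 d2 d3.
have Z1 := @differentiableZ R V R^o g1 a x d1.
have Z2 := @differentiableZ R V R^o g2 b x d2.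
have D12 := @differentiableD R V R^o _ _ x Z1 Z2.
have D123 := @differentiableD R V R^o _ _ x D12 d3.
split=> [|v]; first exact: D123.
have dv (g : V -> R^o) : differentiable g x -> derivable g x v.
  exact: diff_derivable.
have E1 := @deriveD R V R^o _ _ x v (dv _ D12) (dv _ d3).
have E2 := @deriveD R V R^o _ _ x v (dv _ Z1) (dv _ Z2).
have E3 := @deriveZ R V R^o _ a x v (dv _ d1).
have E4 := @deriveZ R V R^o _ b x v (dv _ d2).
by rewrite E2 E3 E4 in E1; exact: E1.
Qed.

Lemma differentiable_ReIm_lin (a : R[i]) z1 z2 x :
  differentiable (Re \o z1 : V -> R) x -> differentiable (Im \o z1 : V -> R) x ->
  differentiable (Re \o z2 : V -> R) x -> differentiable (Im \o z2 : V -> R) x ->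
  [/\ differentiable (Re \o (a *: z1 + z2) : V -> R) x,
      differentiable (Im \o (a *: z1 + z2) : V -> R) x
    & forall j, partial j (a *: z1 + z2) x = a * partial j z1 x + partial j z2 x].
Proof.
move=> dr1 di1 dr2 di2; case: a => p q.
have reE : (Re \o ((p +i* q) *: z1 + z2) : V -> R) =
    (fun y => p * (Re \o z1) y + (- q) * (Im \o z1) y + (Re \o z2) y).
  apply/funext => y; rewrite !fctE /=.
  by case: (z1 y) (z2 y) => [? ?] [? ?] /=; rewrite mulNr.
have imE : (Im \o ((p +i* q) *: z1 + z2) : V -> R) =
    (fun y => p * (Im \o z1) y + q * (Re \o z1) y + (Im \o z2) y).
  apply/funext => y; rewrite !fctE /=.
  by case: (z1 y) (z2 y) => [? ?] [? ?].
have [rD rE] := differentiable_lin3 p (- q) dr1 di1 dr2.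
have [iD iE] := differentiable_lin3 p q di1 dr1 di2.
rewrite /partial reE imE; split => // j.
by rewrite rE iE mulNr.
Qed.

Lemma is_C1c_submod : submod_closed C1c_pred.
Proof.
split.
  have part0 j : partial j (0 : V -> R[i]) = 0.
    apply/funext => x; rewrite /partial.
    rewrite (_ : Re \o 0 = cst 0 :> (V -> R))// (_ : Im \o 0 = cst 0 :> (V -> R))//.
    by rewrite !derive_cst.
  apply/C1cP; split.
  - by move=> x; exact: differentiable_cst.
  - by move=> x; exact: differentiable_cst.
  - by move=> j; rewrite part0; exact: cst_continuous.
  - exact: compact_support0.
move=> a z1 z2 /C1cP[dr1 di1 p1 c1] /C1cP[dr2 di2 p2 c2]; apply/C1cP; split.
- by move=> x; have [] := differentiable_ReIm_lin a (dr1 x) (di1 x) (dr2 x) (di2 x).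
- by move=> x; have [] := differentiable_ReIm_lin a (dr1 x) (di1 x) (dr2 x) (di2 x).
- move=> j.
  have -> : partial j (a *: z1 + z2) = a *: partial j z1 + partial j z2.
    apply/funext => x.
    by have [_ _ ->] := differentiable_ReIm_lin a (dr1 x) (di1 x) (dr2 x) (di2 x).
  move=> x; apply: (@cvgD R[i] R[i]^o V (nbhs x)); last exact: p2.
  have := p1 j x; exact: (@cvgZl_tmp R[i] R[i]^o V (nbhs x) _ a).
- exact: compact_supportD.
Qed.

HB.instance Definition _ := GRing.isSubmodClosed.Build R[i] (V -> R[i])
  C1c_pred is_C1c_submod.

End Spaces.

Record C0c (R : realType) (d : nat) := MkC0c {
  C0c_fun :> 'rV[R]_d -> R[i] ;
  C0c_funP : is_C0c C0c_fun }.

Record C1c (R : realType) (d : nat) := MkC1c {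
  C1c_fun :> 'rV[R]_d -> R[i] ;
  C1c_funP : C1c_fun \in C1c_pred }.

HB.instance Definition _ R d := [isSub for @C1c_fun R d].
HB.instance Definition _ R d := [Choice of C1c R d by <:].
HB.instance Definition _ R d := [SubChoice_isSubLmodule of C1c R d by <:].

Local Notation borel V := (g_sigma_algebraType (@open V)).

Section ChargeIntegral.
Context {R : realType} {dsp : measure_display} {T : measurableType dsp}.
Implicit Types (nu : {charge set T -> \bar R}) (g : T -> R).

Definition hahn_pos nu : set T := sval (cid (Hahn_decomposition nu)).
Definition hahn_neg nu : set T := sval (cid (svalP (cid (Hahn_decomposition nu)))).
Definition hahnP nu : hahn_decomposition nu (hahn_pos nu) (hahn_neg nu) :=
  svalP (cid (svalP (cid (Hahn_decomposition nu)))).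

(* Integral against a signed measure; by uniqueness of the Jordan decomposition
   it does not depend on the chosen Hahn decomposition. *)
Definition charge_integral nu g : R :=
  \int[jordan_pos (hahnP nu)]_x g x - \int[jordan_neg (hahnP nu)]_x g x.

Definition charge_mass nu : R :=
  fine (jordan_pos (hahnP nu) setT) + fine (jordan_neg (hahnP nu) setT).

Definition bmeas g := measurable_fun setT g /\ exists c, forall x, `|g x| <= c.

Lemma bmeas_integrable (mu : {finite_measure set T -> \bar R}) g : bmeas g ->
  mu.-integrable setT (EFin \o g).
Proof.
move=> [mg [c gc]]; apply: measurable_bounded_integrable => //.
  by rewrite ltey_eq fin_num_measure.
exists c; split; first exact: num_real.
by move=> M cM x _ /=; rewrite (le_trans (gc x))// ltW.
Qed.

Lemma bmeas_lin a g1 g2 : bmeas g1 -> bmeas g2 ->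
  bmeas (fun x => a * g1 x + g2 x).
Proof.
move=> [m1 [c1 h1]] [m2 [c2 h2]]; split.
  by apply: measurable_funD => //; exact: measurable_funM.
exists (`|a| * c1 + c2) => x.
by rewrite (le_trans (ler_normD _ _))// lerD// normrM ler_wpM2l.
Qed.

Lemma Rintegral_lin (mu : {finite_measure set T -> \bar R}) a g1 g2 :
  bmeas g1 -> bmeas g2 ->
  \int[mu]_x (a * g1 x + g2 x) = a * \int[mu]_x g1 x + \int[mu]_x g2 x.
Proof.
move=> b1 b2; have i1 := bmeas_integrable mu b1.
have i2 := bmeas_integrable mu b2.
rewrite RintegralD//; first by rewrite RintegralZl.
exact: (integrableZl measurableT a i1).
Qed.

Lemma le_normr_Rintegral_fin (mu : {finite_measure set T -> \bar R}) g c :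
  measurable_fun setT g -> (forall x, `|g x| <= c) ->
  `|\int[mu]_x g x| <= c * fine (mu setT).
Proof.
move=> mg gc; have bg : bmeas g by split => //; exists c.
rewrite (le_trans (le_normr_Rintegral _ (bmeas_integrable mu bg)))//.
rewrite -(@Rintegral_cst _ _ _ mu setT)//; apply: le_Rintegral => //.
- apply: bmeas_integrable; split; first exact: measurableT_comp.
  by exists c => x; rewrite normr_id.
- apply: (@bmeas_integrable _ (cst c)); split; first exact: measurable_cst.
  by exists `|c|.
Qed.

Lemma charge_integral_lin nu a g1 g2 : bmeas g1 -> bmeas g2 ->
  charge_integral nu (fun x => a * g1 x + g2 x) =
  a * charge_integral nu g1 + charge_integral nu g2.
Proof.
move=> b1 b2; rewrite /charge_integral !Rintegral_lin//.
by rewrite mulrBr opprD addrACA.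
Qed.

Lemma le_charge_integral nu g c : measurable_fun setT g ->
  (forall x, `|g x| <= c) -> `|charge_integral nu g| <= c * charge_mass nu.
Proof.
move=> mg gc; rewrite (le_trans (ler_normB _ _))// mulrDr.
by rewrite lerD// le_normr_Rintegral_fin.
Qed.

End ChargeIntegral.

(* M(R^d, C), standing for the dual of C^0_c(R^d, C): charges are finite valued,
   and every finite Borel measure on R^d is Radon. *)
Record cmeasure (R : realType) (d : nat) := CMeasure {
  cmRe : {charge set (borel 'rV[R]_d) -> \bar R} ;
  cmIm : {charge set (borel 'rV[R]_d) -> \bar R} }.

Section Measures.
Context {R : realType} {d : nat}.
Local Notation V := 'rV[R]_d.
Implicit Types (z : V -> R[i]) (mu nu : cmeasure R d).

Definition cintegral mu z : R[i] :=
  (charge_integral (cmRe mu) (Re \o z) - charge_integral (cmIm mu) (Im \o z)) +i*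
  (charge_integral (cmRe mu) (Im \o z) + charge_integral (cmIm mu) (Re \o z)).

(* Charges are only meaningful on measurable sets, hence the restriction to
   Borel sets B. *)
Definition is_pushforward (g : V -> V) mu nu :=
  forall B : set (borel V), measurable B ->
    cmRe nu B = cmRe mu (g @^-1` B) /\ cmIm nu B = cmIm mu (g @^-1` B).

Lemma continuous_borel (g : V -> R) : continuous g ->
  measurable_fun [set: borel V] (g : borel V -> R).
Proof.
move=> /continuousP cg; apply: (measurability _ (RGenOpens.measurableE R)).
move=> _ [_ [a [b ->] <-]]; rewrite setTI; apply: sub_sigma_algebra.
exact/cg/interval_open.
Qed.

Definition supnorm z : R := sup (range (fun x => Normc.normc (z x))).

Definition C1norm z : R := supnorm z + \sum_j supnorm (partial j z).

Lemma normc_le_ReIm (u : R[i]) : Normc.normc u <= `|Re u| + `|Im u|.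
Proof.
case: u => a b /=; rewrite -[leRHS]ger0_norm ?addr_ge0// -sqrtr_sqr.
rewrite ler_wsqrtr// sqrrD !real_normK ?num_real// addrAC lerDl.
by rewrite mulrn_wge0// mulr_ge0.
Qed.

Lemma normr_Re (u : R[i]) : `|Re u| <= Normc.normc u.
Proof. by case: u => a b /=; rewrite -sqrtr_sqr ler_wsqrtr// lerDl sqr_ge0. Qed.

Lemma normr_Im (u : R[i]) : `|Im u| <= Normc.normc u.
Proof. by case: u => a b /=; rewrite -sqrtr_sqr ler_wsqrtr// lerDr sqr_ge0. Qed.

Lemma compact_support_bounded z : continuous (Re \o z : V -> R) ->
  continuous (Im \o z : V -> R) -> compact_support z ->
  exists c, forall x, Normc.normc (z x) <= c.
Proof.
move=> cr ci cz.
have H (g : V -> R) : continuous g -> (forall x, z x = 0 -> g x = 0) ->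
    exists c, forall x, `|g x| <= c.
  move=> cg g0.
  have /compact_bounded[M [_ hM]] : compact (g @` closure [set x | z x != 0]).
    by apply: continuous_compact => //; exact: continuous_subspaceT.
  exists (`|M| + 1) => x; have [zx|zx] := eqVneq (z x) 0.
    by rewrite g0// normr0 addr_ge0.
  apply: hM; first by rewrite (le_lt_trans (ler_norm _))// ltrDl.
  by exists x => //; exact: subset_closure.
have [c1 h1] := H _ cr (fun x zx => congr1 Re zx).
have [c2 h2] := H _ ci (fun x zx => congr1 Im zx).
exists (c1 + c2) => x.
by rewrite (le_trans (normc_le_ReIm _))// lerD// ?h1 ?h2.
Qed.

Lemma le_supnorm z : (exists c, forall x, Normc.normc (z x) <= c) ->
  forall x, Normc.normc (z x) <= supnorm z.
Proof.
move=> [c zc] x; apply: ub_le_sup; last by exists x.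
by exists c => _ [y _ <-] /=.
Qed.

Lemma partial_support j z x : ~ closure [set y | z y != 0] x ->
  partial j z x = 0.
Proof.
move=> nx.
have z0 : \forall y \near nbhs x, z y = 0.
  have : open_nbhs x (~` closure [set y | z y != 0]).
    by split => //; apply: closed_openC; exact: closed_closure.
  move=> /open_nbhs_nbhs; apply: filterS => y /= ny.
  by apply/eqP/negPn/negP => zy; apply: ny; exact: subset_closure.
rewrite /partial.
have H (g : R[i] -> R) : g 0 = 0 -> 'D_(delta_mx 0 j) (g \o z : V -> R) x = 0.
  move=> g0; rewrite (@near_eq_derive _ _ _ _ (cst 0)) ?derive_cst//.
  by near=> y; rewrite /= (near z0 y).
by rewrite !H.
Unshelve. all: by end_near. Qed.

End Measures.

Section Dual.
Context {R : realType} {d : nat}.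
Local Notation V := 'rV[R]_d.
Local Notation D := (C1c R d).

(* Linear functionals on C^1_c(R^d, C) that are bounded for the C^1 norm on
   functions supported in a fixed compact set, i.e. the dual of C^1_c for its
   usual locally convex (inductive limit) topology: distributions of order at
   most 1. A C^1-norm bound uniform in the support would exclude the divergence
   distributions div(g mu): for d = 1, g(x) = x and mu = sum_k k^-2 delta_k, test
   functions with C^1 norm at most 2 and derivative 1 at 1, ..., n give
   |<div(g mu), z>| = sum_(k <= n) 1/k. *)
Definition is_dual (l : D -> R[i]) :=
  linear (l : D -> R[i]^o) /\
  forall K : set V, compact K -> exists M : R, forall z : D,
    (forall x, ~ K x -> z x = 0) -> Normc.normc (l z) <= M * C1norm z.

Definition dual_pred : {pred D -> R[i]} := [pred l | `[< is_dual l >]].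

Lemma dualP (l : D -> R[i]) : reflect (is_dual l) (l \in dual_pred).
Proof. by rewrite inE; exact: asboolP. Qed.

Lemma dual_submod : submod_closed dual_pred.
Proof.
split.
  apply/dualP; split=> [a u v|K _].
    by change (0 = a *: 0 + 0 :> R[i]^o); rewrite scaler0 addr0.
  by exists 0 => z _; rewrite mul0r (_ : (0 : D -> R[i]) z = 0)// Normc.normc0.
move=> a l1 l2 /dualP[lin1 b1] /dualP[lin2 b2]; apply/dualP; split.
  move=> c u v; change (a * l1 (c *: u + v) + l2 (c *: u + v) =
    c * (a * l1 u + l2 u) + (a * l1 v + l2 v)).
  by rewrite lin1 lin2 !mulrDr addrACA !mulrA (mulrC a c).
move=> K cK; have [M1 h1] := b1 K cK; have [M2 h2] := b2 K cK.
exists (Normc.normc a * M1 + M2) => z zK.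
change (Normc.normc (a * l1 z + l2 z) <= (Normc.normc a * M1 + M2) * C1norm z).
rewrite (le_trans (le_normcD _ _))// mulrDl lerD ?h2//.
rewrite Normc.normcM -mulrA ler_wpM2l ?h1//.
by case: (a) => ? ?; exact: sqrtr_ge0.
Qed.

HB.instance Definition _ := GRing.isSubmodClosed.Build R[i] (D -> R[i])
  dual_pred dual_submod.

End Dual.

Record C1c_dual (R : realType) (d : nat) := MkC1cDual {
  dual_fun :> C1c R d -> R[i] ;
  dual_funP : dual_fun \in dual_pred }.

HB.instance Definition _ R d := [isSub for @dual_fun R d].
HB.instance Definition _ R d := [Choice of C1c_dual R d by <:].
HB.instance Definition _ R d := [SubChoice_isSubLmodule of C1c_dual R d by <:].

(* Weak-* topology: initial topology of the evaluations l |-> l z. *)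
HB.instance Definition _ (R : realType) (d : nat) :=
  Topological.copy (C1c_dual R d)
    (initial_topology (@dual_fun R d : _ -> {ptws C1c R d -> R[i]^o})).

Section Functionals.
Context {R : realType} {d : nat}.
Local Notation V := 'rV[R]_d.
Local Notation D := (C1c R d).
Implicit Types (mu nu : cmeasure R d) (g : V -> V).

(* The value 0 is only used outside of the dual; see measure_functionalE and
   divergenceE below. *)
Definition functional (l : D -> R[i]) : C1c_dual R d := insubd 0 l.

Definition measure_functional mu : C1c_dual R d :=
  functional (fun z => cintegral mu z).

Definition grad_dot (z : V -> R[i]) g (x : V) : R[i] :=
  \sum_j partial j z x * (g x 0 j)%:C.

Definition divergence g mu : C1c_dual R d :=
  functional (fun z => - cintegral mu (grad_dot z g)).

Lemma functionalE (l : D -> R[i]) : is_dual l -> functional l = l :> (D -> R[i]).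
Proof. by move=> dl; rewrite /functional insubdK//; exact/dualP. Qed.

Definition cbmeas (z : V -> R[i]) :=
  @bmeas R _ (borel V) (Re \o z) /\ @bmeas R _ (borel V) (Im \o z).

Lemma cbmeasP (z : V -> R[i]) : continuous (Re \o z : V -> R) ->
  continuous (Im \o z : V -> R) -> (exists c, forall x, Normc.normc (z x) <= c) ->
  cbmeas z.
Proof.
move=> cr ci [c zc]; split; split; try exact: continuous_borel.
  by exists c => x; rewrite (le_trans (normr_Re _)).
by exists c => x; rewrite (le_trans (normr_Im _)).
Qed.

Lemma cintegral_lin mu a z1 z2 : cbmeas z1 -> cbmeas z2 ->
  cintegral mu (fun x => a * z1 x + z2 x) = a * cintegral mu z1 + cintegral mu z2.
Proof.
move=> [r1 i1] [r2 i2]; rewrite /cintegral; case: a => p q.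
have -> : Re \o (fun x => (p +i* q) * z1 x + z2 x) =
    (fun x => p * (Re \o z1) x + ((- q) * (Im \o z1) x + (Re \o z2) x)).
  apply/funext => x /=; case: (z1 x) (z2 x) => [? ?] [? ?] /=.
  by rewrite mulNr addrA.
have -> : Im \o (fun x => (p +i* q) * z1 x + z2 x) =
    (fun x => p * (Im \o z1) x + (q * (Re \o z1) x + (Im \o z2) x)).
  apply/funext => x /=; case: (z1 x) (z2 x) => [? ?] [? ?] /=.
  by rewrite addrA.
have b1 := bmeas_lin (- q) i1 r2.
have b2 := bmeas_lin q r1 i2.
rewrite !(@charge_integral_lin R _ (borel V))//.
move: (charge_integral (cmRe mu) (Re \o z1)) (charge_integral (cmRe mu) (Im \o z1))
  (charge_integral (cmIm mu) (Re \o z1)) (charge_integral (cmIm mu) (Im \o z1))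
  (charge_integral (cmRe mu) (Re \o z2)) (charge_integral (cmRe mu) (Im \o z2))
  (charge_integral (cmIm mu) (Re \o z2)) (charge_integral (cmIm mu) (Im \o z2)).
move=> *; apply/eqP; rewrite eq_complex /=; apply/andP.
by split; apply/eqP; ring.
Qed.

Definition cmass mu : R := charge_mass (cmRe mu) + charge_mass (cmIm mu).

Lemma le_cintegral mu z c : cbmeas z -> (forall x, Normc.normc (z x) <= c) ->
  Normc.normc (cintegral mu z) <= c * (cmass mu *+ 2).
Proof.
move=> [[mr _] [mi _]] zc.
have rc x : `|(Re \o z) x| <= c by rewrite (le_trans (normr_Re _)).
have ic x : `|(Im \o z) x| <= c by rewrite (le_trans (normr_Im _)).
have rr := @le_charge_integral _ _ (borel V) (cmRe mu) _ _ mr rc.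
have ri := @le_charge_integral _ _ (borel V) (cmRe mu) _ _ mi ic.
have ir := @le_charge_integral _ _ (borel V) (cmIm mu) _ _ mr rc.
have ii := @le_charge_integral _ _ (borel V) (cmIm mu) _ _ mi ic.
rewrite (le_trans (normc_le_ReIm _))//= mulr2n mulrDr /cmass mulrDr.
rewrite lerD//; first by rewrite (le_trans (ler_normB _ _))// lerD.
by rewrite (le_trans (ler_normD _ _))// lerD.
Qed.

Lemma is_dual_cintegral mu (h : D -> V -> R[i]) :
  (forall a u v x, h (a *: u + v) x = a * h u x + h v x) ->
  (forall z, continuous (Re \o h z : V -> R) /\ continuous (Im \o h z : V -> R)) ->
  (forall K : set V, compact K -> exists M : R, forall z : D,
     (forall x, ~ K x -> z x = 0) -> forall x, Normc.normc (h z x) <= M * C1norm z) ->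
  is_dual (fun z => cintegral mu (h z)).
Proof.
move=> hlin hcont hbnd.
have hb z : cbmeas (h z).
  have [cr ci] := hcont z; apply: cbmeasP => //.
  have /C1cP[_ _ _ cz] := C1c_funP z.
  have [M hM] := hbnd _ cz; exists (M * C1norm z) => x; apply: hM => y ny.
  by apply/eqP/negPn/negP => zy; apply: ny; exact: subset_closure.
split=> [a u v|K cK].
  rewrite (_ : h (a *: u + v) = fun x => a * h u x + h v x).
    exact: cintegral_lin.
  by apply/funext => x; exact: hlin.
have [M hM] := hbnd K cK; exists (M * (cmass mu *+ 2)) => z zK.
by rewrite mulrAC; apply: le_cintegral => //; exact: hM.
Qed.

Lemma C1c_continuous (z : D) : continuous (Re \o z : V -> R) /\
  continuous (Im \o z : V -> R).
Proof.
have /C1cP[dr di _ _] := C1c_funP z.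
by split => x; exact: differentiable_continuous.
Qed.

Lemma C1c_bounded (z : D) : exists c, forall x, Normc.normc (z x) <= c.
Proof.
have /C1cP[dr di _ cz] := C1c_funP z; have [cr ci] := C1c_continuous z.
exact: compact_support_bounded.
Qed.

Lemma C1c_partial_bounded (z : D) j :
  exists c, forall x, Normc.normc (partial j z x) <= c.
Proof.
have /C1cP[dr di cp cz] := C1c_funP z; have [cr ci] := continuous_ReIm (cp j).
apply: compact_support_bounded => //.
apply: subclosed_compact cz _; first exact: closed_closure.
rewrite [X in _ `<=` X]((closure_id _).1 (@closed_closure _ _)).
apply: closureS => x /= px; apply: contrapT => /partial_support p0.
by rewrite p0 eqxx in px.
Qed.

Lemma supnorm_ge0 (z : V -> R[i]) : 0 <= supnorm z.
Proof.
have [H|H] := pselect (has_sup (range (fun x => Normc.normc (z x)))); last first.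
  by rewrite /supnorm sup_out.
apply: le_trans (ub_le_sup H.2 _); last by exists 0.
by case: (z 0) => ? ?; exact: sqrtr_ge0.
Qed.

Lemma le_C1norm (z : D) x : Normc.normc (z x) <= C1norm z.
Proof.
rewrite (le_trans (le_supnorm (C1c_bounded z) x))// lerDl.
by apply: sumr_ge0 => j _; exact: supnorm_ge0.
Qed.

Lemma le_C1norm_partial (z : D) j x : Normc.normc (partial j z x) <= C1norm z.
Proof.
rewrite (le_trans (le_supnorm (C1c_partial_bounded z j) x))//.
rewrite /C1norm (bigD1 j)//= addrCA lerDl addr_ge0 ?supnorm_ge0//.
by apply: sumr_ge0 => k _; exact: supnorm_ge0.
Qed.

Lemma measure_functionalE mu (z : D) :
  measure_functional mu z = cintegral mu z.
Proof.
rewrite /measure_functional functionalE//; apply: is_dual_cintegral => //.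
  exact: C1c_continuous.
by move=> K _; exists 1 => u _ x; rewrite mul1r; exact: le_C1norm.
Qed.

Lemma grad_dot_continuous g (z : D) : continuous g ->
  continuous (Re \o grad_dot z g : V -> R) /\
  continuous (Im \o grad_dot z g : V -> R).
Proof.
move=> cg; have /C1cP[_ _ cp _] := C1c_funP z.
have cgj j : continuous (fun x => g x 0 j).
  move=> x; exact: (@continuous_comp V V R g (fun v : V => v 0 j) x (cg x)
    (@coord_continuous R 1 d 0 j (g x))).
pose P (u : V -> R[i]) := continuous (Re \o u : V -> R) /\ continuous (Im \o u : V -> R).
rewrite -/(P _) (_ : grad_dot z g = \sum_j (fun x => partial j z x * (g x 0 j)%:C)).
  apply: big_ind.
  - by split => x; exact: cst_continuous.
  - move=> u v [ru iu] [rv iv]; split.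
      rewrite (_ : Re \o (u + v) = (Re \o u) \+ (Re \o v)).
        by move=> x; exact: (@cvgD R R^o V (nbhs x) _ _ _ _ _ (ru x) (rv x)).
      by apply/funext => x; rewrite /= !fctE; case: (u x) (v x) => [? ?] [? ?].
    rewrite (_ : Im \o (u + v) = (Im \o u) \+ (Im \o v)).
      by move=> x; exact: (@cvgD R R^o V (nbhs x) _ _ _ _ _ (iu x) (iv x)).
    by apply/funext => x; rewrite /= !fctE; case: (u x) (v x) => [? ?] [? ?].
  - move=> j _; have [cr ci] := continuous_ReIm (cp j); split.
      rewrite (_ : Re \o _ = (Re \o partial j z) \* (fun x => g x 0 j)).
        by move=> x; exact: (@cvgM R V (nbhs x) _ _ _ _ _ (cr x) (cgj j x)).
      by apply/funext => x /=; rewrite mulr0 subr0.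
    rewrite (_ : Im \o _ = (Im \o partial j z) \* (fun x => g x 0 j)).
      by move=> x; exact: (@cvgM R V (nbhs x) _ _ _ _ _ (ci x) (cgj j x)).
    by apply/funext => x /=; rewrite mulr0 add0r mulrC.
by apply/funext => x; rewrite fct_sumE.
Qed.

Lemma is_dual_grad_dot g mu : continuous g ->
  is_dual (fun z : D => cintegral mu (grad_dot z g)).
Proof.
move=> cg; apply: (@is_dual_cintegral mu (fun z => grad_dot z g)).
- move=> a u v x; rewrite /grad_dot mulr_sumr -big_split /=.
  apply: eq_bigr => j _; rewrite mulrA -mulrDl; congr (_ * _).
  have /C1cP[dr1 di1 _ _] := C1c_funP u; have /C1cP[dr2 di2 _ _] := C1c_funP v.
  by have [_ _] := differentiable_ReIm_lin a (dr1 x) (di1 x) (dr2 x) (di2 x); apply.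
- by move=> z; exact: grad_dot_continuous.
move=> K cK.
have /compact_bounded[c0 [_ hc]] : compact (g @` K).
  by apply: continuous_compact => //; exact: continuous_subspaceT.
pose c := `|c0| + 1.
have c_ge0 : 0 <= c by rewrite addr_ge0.
have gc x : K x -> `|g x| <= c.
  move=> Kx; apply: hc; first by rewrite (le_lt_trans (ler_norm _))// ltrDl.
  by exists x.
exists (c *+ d) => z zK x; have [Kx|nKx] := pselect (K x).
  have ncD (r s : R[i]) : Normc.normc (r + s) <= Normc.normc r + Normc.normc s.
    exact: le_normcD.
  have : Normc.normc (grad_dot z g x) <= \sum_(j < d) (c * C1norm z).
    apply: (big_ind2 (fun (r : R[i]) (s : R) => Normc.normc r <= s)).
    - by rewrite Normc.normc0.
    - by move=> r1 s1 r2 s2 h1 h2; rewrite (le_trans (ncD _ _))// lerD.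
    move=> j _; rewrite Normc.normcM mulrC ler_pM//.
    + by case: (_%:C) => ? ?; exact: sqrtr_ge0.
    + by case: (partial _ _ _) => ? ?; exact: sqrtr_ge0.
    + rewrite /= expr0n addr0 sqrtr_sqr (le_trans _ (gc _ Kx))//.
      by rewrite [leRHS]mx_normrE; apply: (le_bigmax _ _ (0, j)).
    + exact: le_C1norm_partial.
  by rewrite sumr_const card_ord -mulrnAl.
rewrite /grad_dot big1 ?Normc.normc0.
  rewrite mulr_ge0 ?mulrn_wge0// addr_ge0 ?supnorm_ge0//.
  by apply: sumr_ge0 => k _; exact: supnorm_ge0.
move=> j _; rewrite partial_support ?mul0r// => zx; apply: nKx.
suff : closure [set y | z y != 0] `<=` K by exact.
have Kcl : closed K by apply: compact_closed => //; exact: norm_hausdorff.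
rewrite [X in _ `<=` X]((closure_id _).1 Kcl); apply: closureS => y /= zy.
by apply: contrapT => /zK z0; rewrite z0 eqxx in zy.
Qed.

Lemma divergenceE g mu (z : D) : continuous g ->
  divergence g mu z = - cintegral mu (grad_dot z g).
Proof.
move=> cg; rewrite /divergence functionalE//.
have : - (fun z : D => cintegral mu (grad_dot z g)) \in dual_pred.
  by rewrite rpredN; apply/dualP; exact: is_dual_grad_dot.
by move/dualP.
Qed.

End Functionals.


Section KuratowskiPainleve.
Context {R : realType} {E : topologicalType}.
Implicit Types (T tau : R) (K : R -> set E).

(* K is only evaluated on [0, T] minus {tau}. *)
Definition KP_liminf T tau K : set E := [set nu | forall N, nbhs nu N ->
  exists2 delta : R, 0 < delta & forall t, t \in `[0, T] ->
    0 < `|t - tau| < delta -> K t `&` N !=set0].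

Definition KP_limsup T tau K : set E := [set nu | forall N, nbhs nu N ->
  forall delta : R, 0 < delta -> exists t, [/\ t \in `[0, T],
    0 < `|t - tau| < delta & K t `&` N !=set0]].

Definition KP_lim_is T tau K (S : set E) :=
  KP_liminf T tau K = S /\ KP_limsup T tau K = S.

End KuratowskiPainleve.

Definition closed_convex_hull {R : realType} {d : nat}
    (A : set (C1c_dual R d)) : set (C1c_dual R d) :=
  closure (smallest (@convex_set R[i] (C1c_dual R d)) A).

(* The pairings are complex valued; the inequality defining the adjoint is read
   on real parts, as in the Hahn-Banach separation theorem over C. *)
Definition process_adjoint {R : realType} {E Y Edual Ydual : Type}
    (pairE : Edual -> E -> R[i]) (pairY : Ydual -> Y -> R[i])
    (F : E -> set Y) (mu : Ydual) : set Edual :=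
  [set nu | forall x,
    ((Re (pairE nu x))%:E <= ereal_sup [set (Re (pairY mu y))%:E | y in F x])%E].

Section ControlSystem.
Context {R : realType} {d : nat} {U : metricType R}.
Local Notation V := 'rV[R]_d.
Local Notation leb := (@completed_lebesgue_measure R).
Local Notation lebR :=
  (caratheodory_type (@wlength R idfun)^*%mu).
Variables (f : V * U -> V) (T : R).

Definition frozen_field (u : U) (x : V) : V := f (x, u).

Definition sublinear_growth := exists2 m : R, 0 < m &
  forall x u, enorm (frozen_field u x) <= m * (1 + enorm x).

Definition locally_lipschitz := forall K : set V, compact K ->
  exists2 l : R, 0 < l & forall x y u, K x -> K y ->
    enorm (frozen_field u x - frozen_field u y) <= l * enorm (x - y).

(* Lebesgue (not only Borel) measurability of the restriction of u to [0, T];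
   values of u outside of [0, T] are irrelevant. *)
Definition control (u : R -> U) :=
  forall B : set U, <<s @open U >> B ->
    measurable (`[0, T] `&` u @^-1` B : set lebR).

Definition oriented_integral (a b : R) (g : R -> R) : R :=
  if a <= b then \int[leb]_(s in `[a, b]) g s
  else - \int[leb]_(s in `[b, a]) g s.

(* Coordinatewise integral equation; integrability is part of the meaning of
   the integral, as non-integrable functions have a junk integral here. *)
Definition controlled_flow (u : R -> U) (Phi : R -> R -> V -> V) :=
  forall tau t, tau \in `[0, T] -> t \in `[0, T] ->
  continuous (Phi tau t) /\
  forall x j, let v s : R := frozen_field (u s) (Phi tau s x) 0 j in
    leb.-integrable `[0, T] (EFin \o v) /\
    Phi tau t x 0 j = x 0 j + oriented_integral tau t v.

(* The flow of u exists and is unique under the growth and Lipschitz assumptions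
   on f, so that Phi below is the controlled flow of u. *)
Definition perron_frobenius (tau t : R) (mu : cmeasure R d) :
    set (cmeasure R d) :=
  [set nu | exists2 u, control u & exists2 Phi, controlled_flow u Phi &
    is_pushforward (Phi tau t) mu nu].

Definition difference_quotient (tau : R) (mu : cmeasure R d) (t : R) :
    set (C1c_dual R d) :=
  [set ((t - tau)^-1)%:C *: (measure_functional nu - measure_functional mu)
     | nu in perron_frobenius tau t mu].

Definition liouville (phi : C1c R d) : set (C0c R d) :=
  [set psi | exists u, psi = grad_dot phi (frozen_field u) :> (V -> R[i])].

Definition liouville_adjoint : cmeasure R d -> set (C1c_dual R d) :=
  process_adjoint (@dual_fun R d)
    (fun mu (psi : C0c R d) => cintegral mu psi) liouville.

Definition minus_divergences (mu : cmeasure R d) : set (C1c_dual R d) :=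
  [set - divergence (frozen_field u) mu | u in [set: U]].

Definition controlled_fields : set (V -> V) := [set frozen_field u | u in [set: U]].

End ControlSystem.

(* Main.v *)
Require Import Defs.
From mathcomp Require Import all_boot all_order all_algebra.
From mathcomp Require Import complex.
From mathcomp Require Import all_classical all_reals all_analysis.
From mathcomp Require Import measurable_realfun ring lra.

Set Implicit Arguments.
Unset Strict Implicit.
Unset Printing Implicit Defensive.

Import Order.TTheory GRing.Theory Num.Theory.
Import numFieldNormedType.Exports.

Local Open Scope classical_set_scope.
Local Open Scope ring_scope.
Local Open Scope complex_scope.

Local Notation Re := (@complex.Re _).
Local Notation Im := (@complex.Im _).
Local Notation normc := Normc.normc.
Local Notation borel V := (g_sigma_algebraType (@open V)).

(** Why the theorem holds. Fix a measure mu and, for a control value u, let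
    sigma_u = - div (f_u mu), so that sigma_u (phi) is the integral of
    grad phi . f_u against mu. Let Phi be the flow of a control u and nu the
    push-forward of mu by Phi (tau, t). Then nu (phi) - mu (phi) is the integral
    against mu of phi (Phi (tau, t) x) - phi (x), and for small |t - tau| this
    increment is, uniformly in x, the derivative of phi at x along the
    displacement Phi (tau, t) x - x. Now cut the time interval into finitely
    many measurable pieces on which u(s) is close to a fixed value p_k, in the
    sense of the fields on a large ball; this is possible because the set of
    controls is compact (control_partition_exists). The displacement is then
    nearly (t - tau) times the average of the f_{p_k} (x), weighted by the
    proportion w_k of time spent in each piece (average_displacement). So the
    difference quotient is, on any finite list of test functions, close to the
    convex combination of the sigma_{p_k} with weights w_k
    (quotient_estimate_seq). Since the weights depend neither on x nor on phi,
    integrals over time and space never have to be exchanged.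

    Both inclusions follow. For the inner limit take the constant control u:
    the combination is sigma_u itself. Its flow is built by Picard iteration;
    the linear growth bound and the Lipschitz bound are propagated along the
    iterates with exponential weights, so that the iterates stay in a ball on
    which the field is Lipschitz and converge on the whole of [0, T]. For the
    outer limit, the combinations lie in the convex hull, and weak-star
    neighbourhoods only see finitely many test functions.

    Let the set of fields be convex, so that the set S of the sigma_u is convex.
    A functional that can be approximated on every finite list of test
    functions by elements of S belongs to S, by compactness of the set of
    controls (range_of_approx). Therefore S is closed and equals its closed
    convex hull, and the two limits coincide with S. The adjoint of the
    Liouville operator consists of the functionals whose real part is bounded
    by the support function of S; it contains S trivially, and conversely
    such a functional cannot be separated from S on a finite list of test
    functions (support_approx), so it belongs to S. *)

(** * Integrals over oriented time intervals *)

Section TimeIntegral.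
Context {R : realType}.
Local Notation leb := (@completed_lebesgue_measure R).
Local Notation lb := (@lebesgue_measure R).
Local Notation lebR := (caratheodory_type (@wlength R idfun)^*%mu).
Implicit Types (a b c : R) (h : R -> R).

Lemma measurable_borel_lebR (A : set (measurableTypeR R)) : measurable A ->
  measurable (A : set lebR).
Proof. exact: sub_caratheodory. Qed.

Lemma completed_lebesgue_itv a b : a <= b -> leb `[a, b]%classic = (b - a)%:E.
Proof.
move=> ab; rewrite (_ : leb _ = lb `[a, b]%classic)// lebesgue_measure_itv/= lte_fin.
by move: ab; rewrite le_eqVlt => /predU1P[->|->]; rewrite ?ltxx ?subrr.
Qed.

Lemma measurable_lebR_itv a b : measurable (`[a, b]%classic : set lebR).
Proof. by apply: measurable_borel_lebR; exact: measurable_itv. Qed.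

Lemma measurable_id_lebR :
  measurable_fun [set: lebR] (idfun : lebR -> measurableTypeR R).
Proof. by move=> _ B mB; rewrite setTI; exact: measurable_borel_lebR. Qed.

Lemma integrable_lebR a b h : continuous h ->
  leb.-integrable `[a, b] (EFin \o h).
Proof.
move=> ch; apply: measurable_bounded_integrable.
- exact: measurable_lebR_itv.
- have [ab|ba] := leP a b; first by rewrite [X in (X < _)%E](completed_lebesgue_itv
    ab) ltry.
  by rewrite set_itv_ge ?measure0// -leNgt bnd_simp.
- apply: measurable_funTS.
  exact: (measurableT_comp (continuous_measurable_fun ch) measurable_id_lebR).
- have /compact_bounded[M [_ hM]] : compact (h @` `[a, b]).
    by apply: continuous_compact; [exact: continuous_subspaceT|exact: segment_compact].
  exists M; split; first exact: num_real.
  by move=> x Mx y aby; apply: hM => //; exists y.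
Qed.

(** The identity is measurable from the completed to the Borel sigma-algebra
    and pushes one measure onto the other; through this identity the
    fundamental theorem of calculus becomes available for the completed
    measure. *)
Lemma Rintegral_lebR a b h : continuous h ->
  \int[leb]_(s in `[a, b]) h s = \int[lb]_(s in `[a, b]) h s.
Proof.
move=> ch; rewrite /Rintegral; congr fine.
have mh : measurable_fun [set: measurableTypeR R] (EFin \o h).
  by apply/measurable_EFinP; exact: continuous_measurable_fun.
have := @integral_pushforward _ _ lebR (measurableTypeR R) R idfun
  measurable_id_lebR leb `[a, b]%classic (EFin \o h) mh (integrable_lebR a b ch)
  (measurable_itv _).
rewrite [in RHS]/comp /= => <-.
by apply: eq_measure_integral => [|mid A mA _]; [exact: measurable_id_lebR|].
Qed.

Lemma integrable_sub a b c e h : a <= c -> e <= b ->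
  leb.-integrable `[a, b] (EFin \o h) -> leb.-integrable `[c, e] (EFin \o h).
Proof.
move=> ac eb; apply: integrableS; [exact: measurable_lebR_itv|exact:
  measurable_lebR_itv|].
by apply: subset_itv; rewrite bnd_simp.
Qed.

Lemma Rintegral_itv_cst a b c : a <= b ->
  \int[leb]_(s in `[a, b]) (cst c) s = c * (b - a).
Proof.
by move=> ab; rewrite Rintegral_cst; [rewrite [X in fine X](completed_lebesgue_itv
  ab)|exact: measurable_lebR_itv].
Qed.

Lemma le_normr_Rintegral_lebR a b h k :
  leb.-integrable `[a, b] (EFin \o h) -> leb.-integrable `[a, b] (EFin \o k) ->
  (forall s, s \in `[a, b] -> `|h s| <= k s) ->
  `|\int[leb]_(s in `[a, b]) h s| <= \int[leb]_(s in `[a, b]) k s.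
Proof.
move=> ih ik hk.
rewrite (le_trans (le_normr_Rintegral (measurable_lebR_itv a b) ih))//.
apply: le_Rintegral => //; first exact: measurable_lebR_itv.
exact: (integrable_norm ih).
Qed.

Lemma oriented_integral_sgn a b h : oriented_integral a b h =
  (-1) ^+ (b < a)%R * \int[leb]_(s in `[Num.min a b, Num.max a b]) h s.
Proof.
rewrite /oriented_integral leNgt minEle maxEle.
by case: (leP a b) => ab /=; rewrite ?expr0 ?mul1r// expr1 mulN1r.
Qed.

(** Oriented integrals are bounded through integrals over this interval,
    whatever the order of a and b. *)
Definition between a b : set R := `[Num.min a b, Num.max a b]%classic.

Lemma between_dist a b s : between a b s -> `|s - a| <= `|b - a|.
Proof.
rewrite /between /= in_itv/= minEle maxEle.
case: (leP a b) => ab /= /andP[h1 h2].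
  by rewrite !ger0_norm ?subr_ge0 ?lerD2r.
by rewrite !ler0_norm ?subr_le0 ?(ltW ab)// lerN2 lerD2r.
Qed.

Lemma max_min_sub a b : Num.max a b - Num.min a b = `|b - a|.
Proof.
rewrite minEle maxEle; case: (leP a b) => ab /=; first by rewrite ger0_norm ?subr_ge0.
by rewrite ler0_norm ?opprB// subr_le0 ltW.
Qed.

Lemma norm_oriented_integral a b h : `|oriented_integral a b h| =
  `|\int[leb]_(s in between a b) h s|.
Proof. by rewrite oriented_integral_sgn normrM normr_sign mul1r. Qed.

Lemma le_oriented_integral_cst a b h c : leb.-integrable (between a b) (EFin \o h) ->
  (forall s, between a b s -> `|h s| <= c) ->
  `|oriented_integral a b h| <= c * `|b - a|.
Proof.
move=> ih hc; rewrite norm_oriented_integral.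
rewrite -max_min_sub -(@Rintegral_itv_cst (Num.min a b));
  last by rewrite ge_min le_max lexx.
apply: le_normr_Rintegral_lebR => //; apply: integrable_lebR; exact: cst_continuous.
Qed.

Lemma oriented_integral_lin a b c h k :
  leb.-integrable (between a b) (EFin \o h) ->
  leb.-integrable (between a b) (EFin \o k) ->
  oriented_integral a b (fun s => c * h s + k s) =
  c * oriented_integral a b h + oriented_integral a b k.
Proof.
move=> ih ik; rewrite !oriented_integral_sgn RintegralD//; last first.
- exact: (integrableZl (measurable_lebR_itv _ _) c ih).
- exact: measurable_lebR_itv.
by rewrite RintegralZl//; [rewrite mulrDr mulrCA|exact: measurable_lebR_itv].
Qed.

(** Subtracting a primitive based to the left of both end points treats the
    two orientations at once; additivity over intervals is then immediate. *)
Lemma oriented_integral_primitive c a b h : continuous h -> c <= a -> c <= b ->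
  oriented_integral a b h =
  \int[lb]_(s in `[c, b]) h s - \int[lb]_(s in `[c, a]) h s.
Proof.
move=> ch ca cb; rewrite /oriented_integral !Rintegral_lebR//.
have il x y : lb.-integrable `[x, y] (EFin \o h).
  apply: continuous_compact_integrable; first exact: segment_compact.
  exact: continuous_subspaceT.
have key x y : c <= x -> x <= y -> \int[lb]_(s in `[x, y]) h s =
    \int[lb]_(s in `[c, y]) h s - \int[lb]_(s in `[c, x]) h s.
  move=> cx xy; rewrite Rintegral_itvB; [|exact: il|by rewrite bnd_simp|by rewrite
    bnd_simp].
  rewrite Rintegral_itv_obnd_cbnd//; apply: integrableS (il x y) => //.
  exact: subset_itv_oc_cc.
by case: leP => ab; rewrite key ?(ltW ab)// opprB.
Qed.

Lemma oriented_integral_chasles a b c h : continuous h ->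
  oriented_integral a c h - oriented_integral a b h = oriented_integral b c h.
Proof.
move=> ch; pose m := Num.min a (Num.min b c).
have [ma mb mc] : [/\ m <= a, m <= b & m <= c].
  by rewrite /m !ge_min !lexx !orbT.
by rewrite !(@oriented_integral_primitive m)//; ring.
Qed.

Lemma oriented_integral_continuous a h : continuous h ->
  continuous (fun t => oriented_integral a t h).
Proof.
move=> ch t; apply/cvgrPdist_le => e e0.
have /compact_bounded[M [_ hM]] : compact (h @` `[t - 1, t + 1]).
  by apply: continuous_compact; [exact: continuous_subspaceT|exact: segment_compact].
pose c := `|M| + 1.
have c0 : 0 < c by rewrite ltr_wpDl.
have hc s : t - 1 <= s <= t + 1 -> `|h s| <= c.
  move=> st; apply: (hM c); first by rewrite (le_lt_trans (ler_norm _))// ltrDl.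
  by exists s => //=; rewrite in_itv.
near=> s.
have st : `|s - t| < Num.min 1 (e / c).
  rewrite distrC; near: s; apply: cvgr_dist_lt => //.
  by rewrite lt_min ltr01 divr_gt0.
have [st1 ste] : `|s - t| < 1 /\ `|s - t| < e / c by move: st; rewrite lt_min => /andP.
rewrite (oriented_integral_chasles a s t ch) (@le_trans _ _ (c * `|t - s|))//;
  last first.
  by rewrite distrC mulrC -ler_pdivlMr// ltW.
apply: le_oriented_integral_cst; first exact: integrable_lebR.
move=> r; rewrite /between/= in_itv/= minEle maxEle => rs.
apply: hc; move: rs st1; rewrite ltr_norml.
by case: (leP s t) => ? /= /andP[? ?] /andP[? ?]; apply/andP; split; lra.
Unshelve. all: by end_near. Qed.

Lemma is_derive_expR_affine (B c s : R) :
  is_derive s 1 (fun s : R => expR (B * (s - c))) (expR (B * (s - c)) * B).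
Proof.
have D1 : is_derive s 1 (fun s : R => B * (s - c)) B.
  have D := @is_deriveZ R R R^o _ B s 1 _
    (@is_deriveB R R R^o _ _ s 1 _ _ (is_derive_id s 1) (is_derive_cst c s 1)).
  by apply: (is_derive_eq D); rewrite subr0; exact: mulr1.
exact: (@is_derive1_comp R expR (fun s : R => B * (s - c)) s _ _
  (is_derive_expR (B * (s - c))) D1).
Qed.

Lemma continuous_expR_affine (B c : R) : continuous (fun s : R => expR (B * (s - c))).
Proof.
move=> s; apply: differentiable_continuous; apply/derivable1_diffP.
by case: (is_derive_expR_affine B c s).
Qed.

Lemma integral_expR a b (B : R) c : a < b -> B != 0 ->
  \int[lb]_(s in `[a, b]) expR (B * (s - c)) =
  (expR (B * (b - c)) - expR (B * (a - c))) / B.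
Proof.
move=> ab B0; pose F := B^-1 *: (fun s : R => expR (B * (s - c))) : R -> R.
have dF (s : R) : is_derive s 1 F (expR (B * (s - c))).
  have D3 := @is_deriveZ R R R^o _ B^-1 s 1 _ (is_derive_expR_affine B c s).
  apply: (is_derive_eq D3).
  by rewrite /GRing.scale/= mulrCA mulVf// mulr1.
have cF : continuous F.
  by move=> s; apply: differentiable_continuous; apply/derivable1_diffP; case: (dF s).
rewrite /Rintegral (@continuous_FTC2 _ _ F)//.
- by rewrite -EFinB /= /F /GRing.scale/= -mulrBr mulrC.
- by apply: continuous_subspaceT; exact: continuous_expR_affine.
- split; first by move=> s _; case: (dF s).
    exact/cvg_at_right_filter/cF.
  exact/cvg_at_left_filter/cF.
- by move=> s _; rewrite derive1E; case: (dF s).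
Qed.

(** The Gronwall-type bound behind the Picard estimates: it makes the weight
    expR (B * `|t - a|) absorb one integration, for both orientations of time.
    The integral of the exponential is computed with rate B or - B according
    to the orientation. *)
Lemma le_oriented_integral_expR a b (A B : R) h : 0 < B -> continuous h ->
  (forall s, between a b s -> `|h s| <= A * B * expR (B * `|s - a|)) ->
  `|oriented_integral a b h| <= A * (expR (B * `|b - a|) - 1).
Proof.
move=> B0 ch; rewrite norm_oriented_integral /between.
have key (x y E c : R) : x < y -> E != 0 ->
    (forall s, x <= s <= y -> `|h s| <= A * B * expR (E * (s - c))) ->
    `|\int[leb]_(s in `[x, y]) h s| <=
      A * B * ((expR (E * (y - c)) - expR (E * (x - c))) / E).
  move=> xy E0 hA; pose k s := (A * B) * expR (E * (s - c)).
  have ck : continuous k.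
    by move=> s; apply: cvgMr; exact: continuous_expR_affine.
  apply: le_trans (le_normr_Rintegral_lebR (integrable_lebR _ _ ch) (integrable_lebR
    _ _ ck) _) _.
    by move=> s sab; apply: hA.
  rewrite Rintegral_lebR// RintegralZl//; last first.
    apply: continuous_compact_integrable; first exact: segment_compact.
    by apply: continuous_subspaceT; exact: continuous_expR_affine.
  by rewrite integral_expR.
have [ab|ba|<-] := ltgtP a b.
- move=> hA; apply: le_trans (key a b B a ab _ _) _; first by rewrite gt_eqF.
    move=> s /andP[sa sb]; rewrite (le_trans (hA s _))//.
      by rewrite /= in_itv/= sa sb.
    by rewrite ger0_norm// subr_ge0.
  rewrite subrr mulr0 expR0 gtr0_norm ?subr_gt0//.
  by rewrite mulrA mulrAC mulfK// gt_eqF.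
- move=> hA; apply: le_trans (key b a (- B) a ba _ _) _;
    first by rewrite oppr_eq0 gt_eqF.
    move=> s /andP[sa sb]; rewrite (le_trans (hA s _))//.
      by rewrite /= in_itv/= sa sb.
    by rewrite mulNr -mulrN ler0_norm// subr_le0.
  rewrite subrr mulr0 expR0 ltr0_norm ?subr_lt0// mulNr -mulrN.
  rewrite (_ : _ / - B = (expR (B * - (b - a)) - 1) / B); last first.
    by rewrite -[1 - _]opprB invrN mulrNN.
  by rewrite mulrA mulrAC mulfK// gt_eqF.
by move=> _; rewrite Rintegral_lebR// set_itv1 Rintegral_set1 subrr !normr0 mulr0
  expR0 subrr mulr0.
Qed.

End TimeIntegral.

(** * Picard iteration for an autonomous field *)

Section VectorNorm.
Context {R : realType} {d : nat}.
Local Notation V := 'rV[R]_d.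

Lemma coord_le_norm (x : V) j : `|x 0 j| <= `|x|.
Proof. by rewrite [leRHS]mx_normrE; apply: (le_bigmax _ _ (0, j)). Qed.

Lemma norm_le_coord (x : V) c : 0 <= c -> (forall j, `|x 0 j| <= c) -> `|x| <= c.
Proof.
move=> c0 xc; rewrite [leLHS]mx_normrE; apply: bigmax_le => //= -[i j] _ /=.
by rewrite ord1.
Qed.

Lemma continuous_coord (T : topologicalType) (h : T -> V) :
  continuous h -> forall j, continuous (fun s => h s 0 j).
Proof.
move=> ch j s; exact: (@continuous_comp T V R h (fun v : V => v 0 j) s (ch s)
  (@coord_continuous R 1 d 0 j (h s))).
Qed.

Lemma continuous_row (T : topologicalType) (h : T -> V) :
  (forall j, continuous (fun s => h s 0 j)) -> continuous h.
Proof.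
move=> ch s; apply/cvgrPdist_le => e e0.
have /filter_forall : forall j, \forall t \near s, `|h s 0 j - h t 0 j| <= e.
  move=> j; have /cvgrPdist_le := ch j s; exact.
apply: filterS => t ht; apply: norm_le_coord; first exact: ltW.
by move=> j; rewrite !mxE ht.
Qed.

End VectorNorm.

Section GeometricLimits.
Context {R : realType}.

Lemma cvg_half_pow (K : R) : K / 2 ^+ n @[n --> \oo] --> 0.
Proof.
have := @cvg_geometric R K (2^-1) _; rewrite ger0_norm ?invr_ge0// invf_lt1// ltr1n
  => /(_ isT).
by apply: cvg_trans; apply: near_eq_cvg; near=> n; rewrite /geometric/= exprVn.
Unshelve. all: by end_near. Qed.

(** Errors of the form K / 2 ^ n disappear in the limit; used both to pass to
    the limit in Picard iterates and to close the bootstrap on the size of a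
    flow. *)
Lemma le_geometric (a b K : R) : (forall n, a <= b + K / 2 ^+ n) -> a <= b.
Proof.
move=> abK; have : b + K / 2 ^+ n @[n --> \oo] --> b + 0.
  by apply: cvgD; [exact: cvg_cst|exact: cvg_half_pow].
rewrite addr0 => cb; apply: (cvgr_to_ge cb); exact: nearW.
Qed.

(** Increments bounded by K / 2 ^ n make the sequence Cauchy, with total tail
    2 K / 2 ^ n. *)
Lemma geometric_limit d (u : nat -> 'rV[R]_d) K :
  (forall n, `|u n.+1 - u n| <= K / 2 ^+ n) ->
  forall n, `|lim (u m @[m --> \oo]) - u n| <= K *+ 2 / 2 ^+ n.
Proof.
move=> uK.
have K0 : 0 <= K by have := uK 0%N; rewrite expr0 divr1; apply: le_trans.
have bnd n k : `|u (n + k)%N - u n| <= K *+ 2 / 2 ^+ n * (1 - 2 ^- k).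
  elim: k => [|k IH]; first by rewrite addn0 subrr normr0 expr0 invr1 subrr mulr0.
  rewrite -(subrKA (u (n + k)%N)) (le_trans (ler_normD _ _))//.
  rewrite addnS (le_trans (lerD (uK _) IH))//.
  rewrite le_eqVlt; apply/orP; left; apply/eqP; rewrite exprD exprS mulr2n.
  by field; rewrite !expf_neq0.
have bnd' n k : (n <= k)%N -> `|u k - u n| <= K *+ 2 / 2 ^+ n.
  move=> /subnKC <-; rewrite (le_trans (bnd _ _))// ler_piMr//.
  by rewrite divr_ge0// ?mulrn_wge0// exprn_ge0.
have cu : cvg (u m @[m --> \oo]).
  apply/cauchy_cvgP/cauchy_exP => e e0.
  have /cvgrPdist_lt/(_ e e0)[n _ hn] := cvg_half_pow (K *+ 2).
  exists (u n); exists n => // k /= nk; rewrite -ball_normE/= distrC.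
  rewrite (le_lt_trans (bnd' _ _ nk))// (le_lt_trans (ler_norm _))//.
  by have := hn n (leqnn n); rewrite sub0r normrN.
move=> n; apply/ler_addgt0Pr => e e0.
have /cvgrPdist_lt/(_ _ e0)[N _ hN] := cu.
have := hN (maxn N n) (leq_maxl _ _) => h1.
rewrite -(subrKA (u (maxn N n))) (le_trans (ler_normD _ _))//.
by rewrite addrC lerD ?bnd' ?leq_maxr// ltW.
Qed.

End GeometricLimits.

Lemma le1_expR (R : realType) (x : R) : 0 <= x -> 1 <= expR x.
Proof. by move=> x0; rewrite -expR0 ler_expR. Qed.

Section VectorIntegral.
Context {R : realType} {d : nat}.
Local Notation V := 'rV[R]_d.
Implicit Types (a b : R) (h k : R -> V).

Definition vintegral a b h : V := \row_j oriented_integral a b (fun s => h s 0 j).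

Lemma vintegralB a b h k : continuous h -> continuous k ->
  vintegral a b (fun s => h s - k s) = vintegral a b h - vintegral a b k.
Proof.
move=> ch ck; apply/rowP => j; rewrite !mxE addrC -mulN1r.
rewrite -oriented_integral_lin; [|exact/integrable_lebR/continuous_coord..].
by congr oriented_integral; apply/funext => s; rewrite !mxE mulN1r addrC.
Qed.

Lemma vintegral_continuous a h : continuous h -> continuous (fun t => vintegral a t h).
Proof.
move=> ch; apply: continuous_row => j.
rewrite (_ : (fun s => _) = fun t => oriented_integral a t (fun s => h s 0 j)).
  exact/oriented_integral_continuous/continuous_coord.
by apply/funext => t; rewrite mxE.
Qed.

Lemma le_vintegral_cst a b h c : 0 <= c -> continuous h ->
  (forall s, between a b s -> `|h s| <= c) -> `|vintegral a b h| <= c * `|b - a|.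
Proof.
move=> c0 ch hc; apply: norm_le_coord; first by rewrite mulr_ge0.
move=> j; rewrite mxE; apply: le_oriented_integral_cst;
  first exact/integrable_lebR/continuous_coord.
by move=> s /hc; apply: le_trans; exact: coord_le_norm.
Qed.

Lemma le_vintegral_expR a b h (A B : R) : 0 <= A -> 0 < B -> continuous h ->
  (forall s, between a b s -> `|h s| <= A * B * expR (B * `|s - a|)) ->
  `|vintegral a b h| <= A * (expR (B * `|b - a|) - 1).
Proof.
move=> A0 B0 ch hA; apply: norm_le_coord.
  by rewrite mulr_ge0// subr_ge0 le1_expR// mulr_ge0// ltW.
move=> j; rewrite mxE; apply: le_oriented_integral_expR => //;
  first exact: continuous_coord.
by move=> s /hA; apply: le_trans; exact: coord_le_norm.
Qed.

End VectorIntegral.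

Section Picard.
Context {R : realType} {d : nat}.
Local Notation V := 'rV[R]_d.
Context (g : V -> V) (m : R) (m0 : 0 < m)
  (g_growth : forall x, `|g x| <= m * (1 + `|x|))
  (g_lip : forall r, exists2 L : R, 0 < L &
     forall x y, `|x| <= r -> `|y| <= r -> `|g x - g y| <= L * `|x - y|).
Implicit Types (a t s r H : R) (x y : V) (n : nat).

Lemma field_continuous : continuous g.
Proof.
move=> x; have [L L0 gL] := g_lip (`|x| + 1).
apply/(@cvgrPdist_le _ _ _ (nbhs x)) => e e0; near=> y.
have xy : `|x - y| < Num.min 1 (e / L).
  by near: y; apply: cvgr_dist_lt => //; rewrite lt_min ltr01 divr_gt0.
have [xy1 xye] : `|x - y| < 1 /\ `|x - y| < e / L by move: xy; rewrite lt_min => /andP.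
apply: le_trans (gL _ _ _ _) _.
- by rewrite lerDl.
- rewrite -[y](subKr x) (le_trans (ler_normB _ _))// lerD2l ltW//.
- by rewrite mulrC -ler_pdivlMr// ltW.
Unshelve. all: by end_near. Qed.

Fixpoint picard a x n t : V :=
  if n is n'.+1 then x + vintegral a t (fun s => g (picard a x n' s)) else x.

Lemma picard_continuous a x n : continuous (picard a x n).
Proof.
elim: n => [|n IH] t; first exact: cst_continuous.
apply: cvgD; first exact: cvg_cst.
apply: vintegral_continuous => s; apply: continuous_comp; first exact: IH.
exact: field_continuous.
Qed.

Lemma picard_field_continuous a x n : continuous (fun s => g (picard a x n s)).
Proof.
by move=> s; apply: continuous_comp; [exact: picard_continuous|exact: field_continuous].
Qed.

(** The bound is stable under the iteration: if it holds for one iterate,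
    linear growth bounds the field along it by (1 + `|x|) m expR (m `|s - a|),
    whose integral gives back the bound. Hence all iterates started in a ball
    stay in a fixed larger ball, on which the field has a single Lipschitz
    constant. *)
Lemma picard_growth a x n t :
  `|picard a x n t| <= (1 + `|x|) * expR (m * `|t - a|) - 1.
Proof.
have x1 : 0 <= 1 + `|x| by rewrite addr_ge0.
elim: n t => [|n IH] t /=.
  by rewrite lerBrDl -[leLHS]mulr1 ler_wpM2l// le1_expR// mulr_ge0// ltW.
rewrite (le_trans (ler_normD _ _))//.
have := @le_vintegral_expR _ _ a t (fun s => g (picard a x n s)) (1 + `|x|) m
  x1 m0 (@picard_field_continuous a x n).
have hs s : between a t s -> `|g (picard a x n s)| <= (1 + `|x|) * m * expR (m * `|s
  - a|).
  move=> _; rewrite (le_trans (g_growth _))// [leRHS]mulrAC [leRHS]mulrC.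
  by rewrite ler_wpM2l ?(ltW m0)// -lerBrDl.
move=> /(_ hs) h; rewrite (le_trans (lerD (lexx `|x|) h))//.
by rewrite le_eqVlt; apply/orP; left; apply/eqP; ring.
Qed.

Definition picard_radius r H := (1 + r) * expR (m * H).

Lemma picard_bound r H a x n t : `|x| <= r -> `|t - a| <= H ->
  `|picard a x n t| <= picard_radius r H.
Proof.
move=> xr tH; rewrite (le_trans (picard_growth _ _ _ _))//.
rewrite (@le_trans _ _ ((1 + `|x|) * expR (m * `|t - a|))) ?gerBl//.
by rewrite ler_pM ?addr_ge0 ?expR_ge0 ?lerD2l// ler_expR ler_wpM2l// ltW.
Qed.

Lemma picard_lipschitz r H : exists L : R, forall a x y n t,
  `|x| <= r -> `|y| <= r -> `|t - a| <= H ->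
  `|picard a x n t - picard a y n t| <= `|x - y| * expR (L * `|t - a|).
Proof.
have [L L0 gL] := g_lip (picard_radius r H); exists L => a x y n t xr yr.
elim: n t => [|n IH] t tH /=.
  by rewrite -[leLHS]mulr1 ler_wpM2l// le1_expR// mulr_ge0// ltW.
rewrite opprD addrACA -vintegralB; [|exact: picard_field_continuous..].
rewrite (le_trans (ler_normD _ _))//.
have := @le_vintegral_expR _ _ a t
  (fun s => g (picard a x n s) - g (picard a y n s)) `|x - y| L (normr_ge0 _) L0.
have cB : continuous (fun s => g (picard a x n s) - g (picard a y n s)).
  by move=> s; apply: cvgB; exact: picard_field_continuous.
have hs s : between a t s -> `|g (picard a x n s) - g (picard a y n s)| <=
    `|x - y| * L * expR (L * `|s - a|).
  move=> /between_dist sa; have sH := le_trans sa tH.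
  rewrite (le_trans (gL _ _ _ _))//; [exact: picard_bound|exact: picard_bound|].
  by rewrite [leRHS]mulrAC [leRHS]mulrC ler_wpM2l ?IH// ltW.
move=> /(_ cB hs) h; rewrite (le_trans (lerD (lexx _) h))//.
by rewrite le_eqVlt; apply/orP; left; apply/eqP; ring.
Qed.

(** The weight expR (2 L `|t - a|) turns the iteration into a contraction of
    ratio 1/2 on time intervals of any length. *)
Lemma picard_step r H : exists K : R, forall a x n t, `|x| <= r -> `|t - a| <= H ->
  `|picard a x n.+1 t - picard a x n t| <= K / 2 ^+ n.
Proof.
have [L L0 gL] := g_lip (picard_radius r H).
have [H0|H0] := ltP H 0.
  by exists 0 => a x n t _ tH; have := le_lt_trans (le_trans (normr_ge0 _) tH) H0;
    rewrite ltxx.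
pose C := m * (1 + `|r|) * H.
have C0 : 0 <= C by rewrite !mulr_ge0 ?addr_ge0// ltW.
exists (C * expR (2 * L * H)) => a x n t xr tH.
suff : `|picard a x n.+1 t - picard a x n t| <= C / 2 ^+ n * expR (2 * L * `|t - a|).
  move=> /le_trans; apply; rewrite mulrAC ler_wpM2r ?invr_ge0 ?exprn_ge0//.
  by rewrite ler_wpM2l// ler_expR ler_wpM2l// mulr_ge0// ltW.
elim: n t tH => [|n IH] t tH.
  rewrite /= addrC addKr expr0 divr1.
  rewrite (@le_trans _ _ (m * (1 + `|r|) * `|t - a|))//.
    apply: le_vintegral_cst; first by rewrite mulr_ge0 ?addr_ge0// ltW.
      exact: cst_continuous.
    move=> s _; rewrite (le_trans (g_growth _))// ler_wpM2l ?(ltW m0)// lerD2l.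
    by rewrite (le_trans xr) ?ler_norm.
  have mr : 0 <= m * (1 + `|r|) by rewrite mulr_ge0 ?(ltW m0)// addr_ge0.
  rewrite -[leLHS]mulr1; apply: ler_pM => //; first by rewrite mulr_ge0.
    by rewrite ler_wpM2l.
  by rewrite le1_expR// !mulr_ge0// ltW.
rewrite [picard a x n.+2 t]/= [X in _ - X]/= opprD addrACA subrr add0r.
rewrite -vintegralB; [|exact: (@picard_field_continuous a x n.+1)|exact:
  picard_field_continuous].
have := @le_vintegral_expR _ _ a t
  (fun s => g (picard a x n.+1 s) - g (picard a x n s)) (C / 2 ^+ n.+1) (2 * L).
have cB : continuous (fun s => g (picard a x n.+1 s) - g (picard a x n s)).
  by move=> s; apply: cvgB; exact: picard_field_continuous.
have hs s : between a t s -> `|g (picard a x n.+1 s) - g (picard a x n s)| <=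
    C / 2 ^+ n.+1 * (2 * L) * expR (2 * L * `|s - a|).
  move=> /between_dist sa; have sH := le_trans sa tH.
  rewrite (le_trans (gL _ _ _ _))//; [exact: picard_bound|exact: picard_bound|].
  rewrite (_ : C / 2 ^+ n.+1 * (2 * L) = L * (C / 2 ^+ n)).
    by rewrite -mulrA ler_wpM2l ?IH// ltW.
  by rewrite exprS; field; rewrite expf_neq0.
have C1 : 0 <= C / 2 ^+ n.+1 by rewrite divr_ge0// exprn_ge0.
move=> /(_ C1 (mulr_gt0 (ltr0Sn R 1) L0) cB hs) => /le_trans; apply.
by rewrite ler_wpM2l// gerBl.
Qed.

Definition autonomous_flow a t x : V := lim (picard a x n t @[n --> \oo]).

Lemma picard_cvg r H : exists K : R, forall a x n t, `|x| <= r -> `|t - a| <= H ->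
  `|autonomous_flow a t x - picard a x n t| <= K / 2 ^+ n.
Proof.
have [K hK] := picard_step r H; exists (K *+ 2) => a x n t xr tH.
exact: (@geometric_limit R d (fun n => picard a x n t) K (fun k => hK a x k t xr tH)).
Qed.

Lemma autonomous_flow_bound r H a t x : `|x| <= r -> `|t - a| <= H ->
  `|autonomous_flow a t x| <= picard_radius r H.
Proof.
move=> xr tH; have [K hK] := picard_cvg r H; apply: (@le_geometric _ _ _ K) => n.
rewrite -[X in `|X|](subrK (picard a x n t)) (le_trans (ler_normD _ _))//.
by rewrite addrC lerD ?hK// picard_bound.
Qed.

Lemma autonomous_flow_continuous_time a x : continuous (fun t => autonomous_flow a t x).
Proof.
move=> t; have [K hK] := picard_cvg `|x| (`|t - a| + 1).
apply/(@cvgrPdist_lt _ _ _ (nbhs t)) => e e0.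
have e3 : 0 < e / 3 by rewrite divr_gt0.
have /cvgrPdist_lt/(_ _ e3)[n _ hn] := cvg_half_pow K.
have {}hn : K / 2 ^+ n < e / 3.
  by rewrite (le_lt_trans (ler_norm _))// -normrN -sub0r; exact: (hn n (leqnn n)).
have /(@cvgrPdist_lt _ _ _ (nbhs t))/(_ _ e3) ct := @picard_continuous a x n t.
have /(@cvgrPdist_lt _ _ _ (nbhs t))/(_ _ ltr01) c1 : s @[s --> t] --> t by exact:
  cvg_id.
near=> s.
have sH : `|s - a| <= `|t - a| + 1.
  by rewrite -(subrKA t) (le_trans (ler_normD _ _))// addrC lerD2l distrC ltW//.
have h1 := hK a x n t (lexx _) (ltW (ltr_pwDr ltr01 (lexx _))).
have h2 := hK a x n s (lexx _) sH.
have h3 : `|picard a x n t - picard a x n s| < e / 3 by near: s.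
rewrite -(subrKA (picard a x n t)) (le_lt_trans (ler_normD _ _))//.
rewrite -(subrKA (picard a x n s) (picard a x n t)).
rewrite (_ : e = e / 3 + (e / 3 + e / 3)); last by field.
rewrite ltrD ?(le_lt_trans h1)// (le_lt_trans (ler_normD _ _))// ltrD//.
by rewrite distrC (le_lt_trans h2).
Unshelve. all: by end_near. Qed.

Lemma autonomous_field_continuous a x : continuous (fun s => g (autonomous_flow a s x)).
Proof.
move=> s; apply: (@continuous_comp _ _ _ (fun s => autonomous_flow a s x) g).
  exact: autonomous_flow_continuous_time.
exact: field_continuous.
Qed.

(** The iterates converge uniformly in time and stay where the field is
    Lipschitz, so both sides of the recursion pass to the limit. *)
Lemma autonomous_flow_eq a t x :
  autonomous_flow a t x = x + vintegral a t (fun s => g (autonomous_flow a s x)).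
Proof.
apply/eqP; rewrite -subr_eq0 -normr_le0.
have [K hK] := picard_cvg `|x| `|t - a|.
have [L L0 gL] := g_lip (picard_radius `|x| `|t - a|).
apply: (@le_geometric _ _ _ (K / 2 + L * K * `|t - a|)) => n; rewrite add0r.
rewrite -(subrKA (picard a x n.+1 t)) (le_trans (ler_normD _ _))//.
have h1 := hK a x n.+1 t (lexx _) (lexx _).
rewrite mulrDl lerD//; first by rewrite (le_trans h1)// exprS invfM mulrA.
rewrite /= opprD addrACA subrr add0r.
rewrite -vintegralB; [|exact: picard_field_continuous|exact:
  autonomous_field_continuous].
rewrite mulrAC; apply: le_vintegral_cst.
- have K0 := le_trans (normr_ge0 _) (hK a x n t (lexx _) (lexx _)).
  by rewrite -mulrA mulr_ge0// ltW.
- by move=> s; apply: cvgB; [exact: picard_field_continuous|exact: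
    autonomous_field_continuous].
move=> s /between_dist sa.
rewrite (le_trans (gL _ _ _ _))//; [exact: picard_bound|exact: autonomous_flow_bound|].
by rewrite -mulrA ler_wpM2l ?(ltW L0)// distrC; exact: hK.
Qed.

Lemma autonomous_flow_continuous a t : continuous (autonomous_flow a t).
Proof.
move=> x; have [K hK] := picard_cvg (`|x| + 1) `|t - a|.
have [L hL] := picard_lipschitz (`|x| + 1) `|t - a|.
pose M := expR (L * `|t - a|).
have lip y : `|y| <= `|x| + 1 ->
    `|autonomous_flow a t x - autonomous_flow a t y| <= M * `|x - y|.
  move=> yr; apply: (@le_geometric _ _ _ (K *+ 2)) => n.
  have xr : `|x| <= `|x| + 1 by rewrite lerDl.
  have h1 := hK a x n t xr (lexx _); have h2 := hK a y n t yr (lexx _).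
  have h3 := hL a x y n t xr yr (lexx _).
  rewrite -(subrKA (picard a x n t)) (le_trans (ler_normD _ _))//.
  rewrite -(subrKA (picard a y n t) (picard a x n t)).
  rewrite (le_trans (lerD h1 (ler_normD _ _)))// [in X in _ + (_ + X)]distrC.
  rewrite (le_trans (lerD (lexx _) (lerD h3 h2)))// mulr2n mulrDl /M mulrC.
  by rewrite le_eqVlt; apply/orP; left; apply/eqP; ring.
apply/(@cvgrPdist_le _ _ _ (nbhs x)) => e e0; near=> y.
have xy : `|x - y| < Num.min 1 (e / M).
  by near: y; apply: cvgr_dist_lt => //; rewrite lt_min ltr01 divr_gt0// expR_gt0.
have [xy1 xye] : `|x - y| < 1 /\ `|x - y| < e / M by move: xy; rewrite lt_min => /andP.
rewrite (le_trans (lip _ _))//.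
  by rewrite -[y](subKr x) (le_trans (ler_normB _ _))// lerD2l ltW.
by rewrite mulrC -ler_pdivlMr ?expR_gt0// ltW.
Unshelve. all: by end_near. Qed.

End Picard.

(** * Flows of constant controls *)

Section EuclideanNorm.
Context {R : realType} {d : nat}.
Local Notation V := 'rV[R]_d.

Lemma norm_le_enorm (x : V) : `|x| <= enorm x.
Proof.
apply: norm_le_coord => [|j]; first exact: sqrtr_ge0.
rewrite -sqrtr_sqr ler_wsqrtr// (bigD1 j)//= lerDl.
by apply: sumr_ge0 => i _; exact: sqr_ge0.
Qed.

(** Together with norm_le_enorm, this transfers the hypotheses on the
    Euclidean norm to the maximum norm, at the price of a factor depending on
    the dimension. *)
Lemma enorm_le_norm (x : V) : enorm x <= d%:R * `|x|.
Proof.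
have d0 : 0 <= d%:R * `|x| by rewrite mulr_ge0.
rewrite -[leRHS]ger0_norm// -sqrtr_sqr ler_wsqrtr// exprMn.
rewrite (@le_trans _ _ (\sum_(j < d) `|x| ^+ 2))//.
  by apply: ler_sum => j _; rewrite -real_normK ?num_real// lerXn2r ?nnegrE
    ?coord_le_norm.
rewrite sumr_const card_ord -[leLHS]mulr_natl ler_wpM2r ?sqr_ge0//.
by rewrite -natrX ler_nat; case: (d) => // n; rewrite expnS expn1 leq_pmulr.
Qed.

End EuclideanNorm.

Section ConstantControl.
Context {R : realType} {d : nat} {U : metricType R}.
Local Notation V := 'rV[R]_d.
Context {f : V * U -> V} (f_growth : sublinear_growth f) (f_lip : locally_lipschitz f).

Lemma growth_max_norm : exists2 m : R, 0 < m &
  forall x u, `|frozen_field f u x| <= m * (1 + `|x|).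
Proof.
have [m m0 fm] := f_growth; exists (m * d.+1%:R); first by rewrite mulr_gt0.
move=> x u; rewrite (le_trans (norm_le_enorm _))// (le_trans (fm x u))// -mulrA.
rewrite ler_wpM2l ?(ltW m0)// mulrDr mulr1 lerD//; first by rewrite ler1n.
by rewrite (le_trans (enorm_le_norm x))// ler_wpM2r// ler_nat.
Qed.

Lemma compact_closed_ball r : compact [set x : V | `|x| <= r].
Proof.
apply: bounded_closed_compact.
  by exists r; split => [|M rM x /= xr]; [exact: num_real|rewrite (le_trans xr)// ltW].
rewrite (_ : [set x | _] = (fun x : V => `|x|) @^-1` [set t : R | t <= r])//.
by apply: closed_comp => [x _|]; [exact: norm_continuous|exact: closed_le].
Qed.

Lemma lipschitz_max_norm r : exists2 L : R, 0 < L & forall u x y,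
  `|x| <= r -> `|y| <= r ->
  `|frozen_field f u x - frozen_field f u y| <= L * `|x - y|.
Proof.
have [l l0 fl] := f_lip (@compact_closed_ball r).
exists (l * d.+1%:R); first by rewrite mulr_gt0.
move=> u x y xr yr; rewrite (le_trans (norm_le_enorm _))// (le_trans (fl x y u xr
  yr))//.
rewrite -mulrA ler_wpM2l ?(ltW l0)//.
by rewrite (le_trans (enorm_le_norm _))// ler_wpM2r// ler_nat.
Qed.

Lemma frozen_field_continuous u : continuous (frozen_field f u).
Proof.
apply: field_continuous => r; have [L L0 fL] := lipschitz_max_norm r.
by exists L => // x y; exact: fL.
Qed.

Lemma constant_control_flow (T : R) u : exists Phi, controlled_flow f T (fun=> u) Phi.
Proof.
have [m m0 fm] := growth_max_norm.
pose g := frozen_field f u.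
have gm x : `|g x| <= m * (1 + `|x|) by exact: fm.
have gl r : exists2 L : R, 0 < L & forall x y,
    `|x| <= r -> `|y| <= r -> `|g x - g y| <= L * `|x - y|.
  have [L L0 fL] := lipschitz_max_norm r.
  by exists L => // x y; exact: fL.
exists (autonomous_flow g) => tau t _ _; split.
  exact: (autonomous_flow_continuous m0 gm gl).
move=> x j; split.
  apply: integrable_lebR; apply: continuous_coord.
  exact: (autonomous_field_continuous m0 gm gl).
by rewrite (autonomous_flow_eq m0 gm gl) !mxE.
Qed.

Lemma constant_control (T : R) u : control T (fun=> u : U).
Proof.
move=> B _; have [Bu|nBu] := pselect (B u).
  rewrite (_ : _ `&` _ = `[0, T]%classic); first exact: measurable_lebR_itv.
  by apply/seteqP; split => x /=; [case|].
rewrite (_ : _ `&` _ = set0); first exact: measurable0.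
by apply/seteqP; split => x //= [_].
Qed.

End ConstantControl.

(** * Integration against push-forwards of charges *)

Section ChargePushforward.
Context {R : realType} {d1 d2 : measure_display}
  {T1 : measurableType d1} {T2 : measurableType d2} (g : T1 -> T2)
  (mg : measurable_fun setT g).

Lemma bmeas_comp h : bmeas h -> bmeas (R := R) (h \o g).
Proof.
move=> [mh [c hc]]; split; first exact: measurableT_comp mh mg.
by exists c => x; exact: hc.
Qed.

Lemma jordan_decompB d (X : measurableType d) (nu : {charge set X -> \bar R}) A :
  measurable A ->
  nu A = (jordan_pos (hahnP nu) A - jordan_neg (hahnP nu) A)%E.
Proof. by move=> mA; rewrite (jordan_decomp (hahnP nu) mA) /cadd/= cscaleN1. Qed.

(** The push-forward of a Jordan decomposition need not be a Jordan
    decomposition. Instead, with p1 - n1 and p2 - n2 the decompositions of nu1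
    and nu2, the positive measures p2 + g n1 and n2 + g p1 coincide, hence
    have the same integrals, and all the integrals are finite. *)
Lemma charge_integral_pushforward (nu1 : {charge set T1 -> \bar R})
    (nu2 : {charge set T2 -> \bar R}) h :
  (forall B, measurable B -> nu2 B = nu1 (g @^-1` B)) -> bmeas h ->
  charge_integral nu2 h = charge_integral nu1 (h \o g).
Proof.
move=> nu21 bh; have bhg := bmeas_comp bh.
pose p1 : {finite_measure set T1 -> \bar R} := jordan_pos (hahnP nu1).
pose n1 : {finite_measure set T1 -> \bar R} := jordan_neg (hahnP nu1).
pose p2 : {finite_measure set T2 -> \bar R} := jordan_pos (hahnP nu2).
pose n2 : {finite_measure set T2 -> \bar R} := jordan_neg (hahnP nu2).
have mh : measurable_fun setT (EFin \o h) by apply/measurable_EFinP; case: bh.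
pose q (mu : {finite_measure set T1 -> \bar R}) : {measure set T2 -> \bar R} :=
  measure_function_pushforward__canonical__measure_function_Measure mu mg.
have push (mu : {finite_measure set T1 -> \bar R}) :
    (\int[q mu]_x (h x)%:E = \int[mu]_x (h (g x))%:E)%E /\
    (q mu).-integrable setT (EFin \o h).
  split; last exact: (integrable_pushforward mg mh (bmeas_integrable mu bhg)).
  exact: (integral_pushforward mg mh (bmeas_integrable mu bhg)).
have [pE pI] := push p1; have [nE nI] := push n1.
have E : (\int[measure_add p2 (q n1)]_x (h x)%:E =
    \int[measure_add n2 (q p1)]_x (h x)%:E)%E.
  apply: eq_measure_integral => A mA _.
  have mgA : measurable (g @^-1` A) by rewrite -[X in measurable X]setTI; exact: mg.
  have := nu21 A mA; rewrite (jordan_decompB nu1 mgA) (jordan_decompB nu2 mA).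
  rewrite -/p1 -/p2 -/n1 -/n2.
  rewrite /measure_add/= /msum !big_ord_recl !big_ord0 /= !adde0 /pushforward.
  rewrite -(fineK (fin_num_measure p1 _ mgA)) -(fineK (fin_num_measure n1 _ mgA)).
  rewrite -(fineK (fin_num_measure p2 _ mA)) -(fineK (fin_num_measure n2 _ mA)).
  rewrite -!EFinB -!EFinD => -[H]; congr EFin.
  lra.
have Ip2 := bmeas_integrable p2 bh; have In2 := bmeas_integrable n2 bh.
rewrite !integral_measure_add// pE nE in E.
have Ip1 := bmeas_integrable p1 bhg; have In1 := bmeas_integrable n1 bhg.
move: E; rewrite /charge_integral /Rintegral -/p1 -/p2 -/n1 -/n2.
rewrite -(fineK (integrable_fin_num measurableT Ip2)) -(fineK (integrable_fin_num
  measurableT In2)).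
rewrite -(fineK (integrable_fin_num measurableT Ip1)) -(fineK (integrable_fin_num
  measurableT In1)).
rewrite -!EFinD /= => -[H]; rewrite /comp.
lra.
Qed.

End ChargePushforward.

Section Pushforward.
Context {R : realType} {d : nat}.
Local Notation V := 'rV[R]_d.
Implicit Types (z : V -> R[i]) (mu nu : cmeasure R d).

Lemma continuous_measurable_borel (g : V -> V) : continuous g ->
  measurable_fun [set: borel V] (g : borel V -> borel V).
Proof.
move=> /continuousP cg.
apply: (@measurability _ _ (borel V) (borel V) setT g (@open V)) => //.
by move=> _ [B oB <-]; rewrite setTI; apply: sub_sigma_algebra; exact: cg.
Qed.

Lemma pushforward_exists (g : V -> V) mu : continuous g ->
  exists nu, is_pushforward g mu nu.
Proof.
move=> /continuous_measurable_borel mg.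
pose rho (c : {charge set (borel V) -> \bar R}) : {charge set (borel V) -> \bar R} :=
  measure_function_pushforward__canonical__charge_Charge c mg.
by exists (CMeasure (rho (cmRe mu)) (rho (cmIm mu))).
Qed.

End Pushforward.

(** * Uniform first-order expansions *)

Section UniformTaylor.
Context {R : realType} {d : nat}.
Local Notation V := 'rV[R]_d.
Implicit Types (F G : V -> R) (x y v : V).

(** A Heine argument: near-covering compactness of a ball slightly larger than
    the support gives a common modulus; farther away both values vanish. *)
Lemma uniform_continuity G r : continuous G -> (forall x, r < `|x| -> G x = 0) ->
  forall e, 0 < e -> exists2 delta, 0 < delta &
    forall x y, `|x - y| < delta -> `|G x - G y| <= e.
Proof.
move=> cG G0 e e0.
have /compact_near_coveringP nc := @compact_closed_ball R d (r + 1).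
have := nc R 0^'+ (fun delta x => forall y, `|x - y| < delta -> `|G x - G y| <= e) _.
have H x : `|x| <= r + 1 -> \forall x' \near x & delta \near 0^'+,
    forall y, `|x' - y| < delta -> `|G x' - G y| <= e.
  move=> _; have e2 : 0 < e / 2 by rewrite divr_gt0.
  have /cvgrPdist_lt/(_ _ e2) := cG x; move=> /nbhs_ballP[eta /= eta0 hx].
  have eta2 : 0 < eta / 2 by rewrite divr_gt0.
  exists (ball x (eta / 2), [set t | t < eta / 2]) => /=.
    split; first exact: nbhsx_ballx.
    exact: nbhs_right_lt.
  move=> [x' t] /=; rewrite -ball_normE/= => -[xx' te] y x'y.
  have h1 : `|G x - G x'| < e / 2.
    by apply: hx; rewrite -ball_normE/= (lt_trans xx')// gtr_pMr// invf_lt1// ltr1n.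
  have h2 : `|G x - G y| < e / 2.
    apply: hx; rewrite -ball_normE/= -(subrKA x') (le_lt_trans (ler_normD _ _))//.
    by rewrite [eta]splitr ltrD// (lt_trans x'y).
  rewrite -(subrKA (G x)) (le_trans (ler_normD _ _))// [e]splitr.
  by rewrite ltW// ltrD// distrC.
move=> /(_ _ H) N; near (0 : R)^'+ => delta.
have hd : [set x | `|x| <= r + 1] `<=` [set x | forall y, `|x - y| < delta -> `|G x -
  G y| <= e].
  by near: delta.
have d1 : delta < 1 by near: delta; exact: nbhs_right_lt.
exists delta; first by near: delta; exact: nbhs_right_gt.
move=> x y xy; have [xr|xr] := leP `|x| (r + 1); first exact: hd.
rewrite G0; last by rewrite (lt_trans _ xr)// ltrDl.
rewrite G0 ?subrr ?normr0 ?(ltW e0)//.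
rewrite -(ltrD2r 1) (lt_le_trans xr)// -{1}[x](subrK y) addrC.
by rewrite (le_trans (ler_normD _ _))// lerD2l ltW// (lt_trans xy).
Unshelve. all: by end_near. Qed.

Lemma derive_partials F x v : differentiable F x ->
  'D_v F x = \sum_j v 0 j * 'D_(delta_mx 0 j) F x.
Proof.
move=> dF; rewrite deriveE// {1}(row_sum_delta v) linear_sum /=.
by apply: eq_bigr => j _; rewrite linearZ/= deriveE.
Qed.

Lemma is_derive_line F x v s : differentiable F (x + s *: v) ->
  is_derive s 1 (fun s : R => F (x + s *: v)) ('D_v F (x + s *: v)).
Proof.
move=> dF; have E : (fun h : R => h^-1 *: (((fun s : R => F (x + s *: v)) \o shift s)
  (h *: 1)
      - F (x + s *: v))) =
    (fun h : R => h^-1 *: ((F \o shift (x + s *: v)) (h *: v) - F (x + s *: v))).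
  apply/funext => h /=; congr (_ *: (F _ - _)).
  by rewrite scalerDl addrCA; congr (_ *: _ + _); exact: mulr1.
split; first by rewrite /derivable E; exact: diff_derivable.
by rewrite /derive E.
Qed.

Lemma mean_value F x y : (forall z, differentiable F z) -> exists2 s,
  s \in `[0, 1] & F y - F x = 'D_(y - x) F (x + s *: (y - x)).
Proof.
move=> dF; have D s := @is_derive_line F x (y - x) s (dF _).
have [|s s01] := @MVT_segment R (fun s : R => F (x + s *: (y - x))) _ 0 1 ler01 (fun
  s _ => D s).
  apply: continuous_subspaceT => s; apply: differentiable_continuous.
  by apply/derivable1_diffP; case: (D s).
by rewrite subr0 mulr1 scale1r scale0r addr0 subrKC => E; exists s.
Qed.

(** By the mean value theorem the error is an increment of the partial
    derivatives times `|y - x|, and these are uniformly continuous because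
    they vanish outside of a ball. *)
Lemma uniform_taylor F r : (forall z, differentiable F z) ->
  (forall j, continuous (fun z => 'D_(delta_mx 0 j) F z)) ->
  (forall j x, r < `|x| -> 'D_(delta_mx 0 j) F x = 0) ->
  forall e, 0 < e -> exists2 delta, 0 < delta & forall x y, `|y - x| < delta ->
    `|F y - F x - \sum_j (y - x) 0 j * 'D_(delta_mx 0 j) F x| <= e * `|y - x|.
Proof.
move=> dF cF F0 e e0.
have ed : 0 < e / d.+1%:R by rewrite divr_gt0.
have /choice[delta hdelta] : forall j, exists delta, 0 < delta /\
    forall x y, `|x - y| < delta ->
    `|'D_(delta_mx 0 j) F x - 'D_(delta_mx 0 j) F y| <= e / d.+1%:R.
  by move=> j; have [D D0 hD] := uniform_continuity (cF j) (F0 j) ed; exists D.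
exists (\big[Num.min/1]_j delta j).
  by apply: lt_bigmin => // j _; case: (hdelta j).
move=> x y xy; have [s s01 ->] := mean_value x y dF.
rewrite derive_partials// -sumrB (le_trans (ler_norm_sum _ _ _))//.
have h j : `|(y - x) 0 j * 'D_(delta_mx 0 j) F (x + s *: (y - x))
    - (y - x) 0 j * 'D_(delta_mx 0 j) F x| <= e / d.+1%:R * `|y - x|.
  rewrite -mulrBr normrM mulrC ler_pM ?coord_le_norm//.
  apply: (hdelta j).2; rewrite addrC addKr normrZ.
  rewrite (@le_lt_trans _ _ `|y - x|)//.
    by rewrite ler_piMl// ger0_norm (itvP s01).
  by rewrite (lt_le_trans xy)// bigmin_le_cond.
rewrite (le_trans (ler_sum _ (fun j _ => h j)))// sumr_const card_ord -[leLHS]mulr_natl.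
rewrite mulrA ler_wpM2r// mulrCA ler_piMr ?(ltW e0)// ler_pdivrMr// mul1r ler_nat.
exact: leqnSn.
Qed.

End UniformTaylor.

(** * Test functions *)

Section TestFunctions.
Context {R : realType} {d : nat}.
Local Notation V := 'rV[R]_d.
Local Notation D := (C1c R d).
Implicit Types (phi : D) (x y : V).

Lemma C1c_radius phi : exists2 r : R, 0 <= r & forall x, r < `|x| ->
  phi x = 0 /\ forall j, partial j phi x = 0.
Proof.
have /C1cP[_ _ _ cz] := C1c_funP phi.
have [M [_ hM]] := compact_bounded cz.
exists (`|M| + 1); first by rewrite addr_ge0.
move=> x xr; have nx : ~ closure [set y | phi y != 0] x.
  move=> cx; have := hM (`|M| + 1); rewrite (le_lt_trans (ler_norm _)) ?ltrDl//.
  by move=> /(_ isT x cx) /(lt_le_trans xr); rewrite ltxx.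
split; last by move=> j; exact: partial_support.
by apply/eqP/negPn/negP => zx; apply: nx; exact: subset_closure.
Qed.

Lemma normc_ge0 (z : R[i]) : 0 <= normc z.
Proof. by case: z => a b; exact: sqrtr_ge0. Qed.

Lemma normc_real (a : R) : normc a%:C = `|a|.
Proof. by rewrite /= expr0n addr0 sqrtr_sqr. Qed.

Lemma normc_sum (I : Type) (s : seq I) (F : I -> R[i]) :
  normc (\sum_(i <- s) F i) <= \sum_(i <- s) normc (F i).
Proof.
elim/big_ind2 : _ => [|a b c e h1 h2|//]; first by rewrite Normc.normc0.
by rewrite (le_trans (le_normcD _ _))// lerD.
Qed.

Lemma le_grad_dot phi (g : V -> V) x :
  normc (grad_dot phi g x) <= d%:R * C1norm phi * `|g x|.
Proof.
rewrite /grad_dot (le_trans (normc_sum _ _))//.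
rewrite (@le_trans _ _ (\sum_(j < d) C1norm phi * `|g x|))//; last first.
  by rewrite sumr_const card_ord -[leLHS]mulr_natl mulrA.
apply: ler_sum => j _; rewrite Normc.normcM normc_real.
by rewrite ler_pM ?normc_ge0 ?le_C1norm_partial ?coord_le_norm.
Qed.

Lemma C1norm_ge0 phi : 0 <= C1norm phi.
Proof. by rewrite addr_ge0 ?supnorm_ge0// sumr_ge0// => j _; exact: supnorm_ge0. Qed.

Lemma grad_dotB phi (g1 g2 : V -> V) x :
  grad_dot phi (fun x => g1 x - g2 x) x = grad_dot phi g1 x - grad_dot phi g2 x.
Proof.
rewrite /grad_dot -sumrB; apply: eq_bigr => j _.
by rewrite !mxE -mulrBr; congr (_ * _); rewrite rmorphB.
Qed.

Lemma grad_dot_lincomb phi n (w : 'I_n -> R) (g : 'I_n -> V -> V) x :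
  grad_dot phi (fun x => \sum_k w k *: g k x) x =
  \sum_k (w k)%:C * grad_dot phi (g k) x.
Proof.
rewrite /grad_dot; under [RHS]eq_bigr do rewrite mulr_sumr.
rewrite exchange_big/=; apply: eq_bigr => j _.
rewrite summxE rmorph_sum mulr_sumr; apply: eq_bigr => k _.
by rewrite mxE rmorphM mulrCA.
Qed.

Lemma C1c_taylor phi e : 0 < e -> exists2 delta : R, 0 < delta &
  forall x y, `|y - x| < delta ->
  normc (phi y - phi x - grad_dot phi (fun=> y - x) x) <= e * `|y - x|.
Proof.
move=> e0; have /C1cP[dr di cp _] := C1c_funP phi.
have [r r0 hr] := C1c_radius phi.
have cpr j := (continuous_ReIm (cp j)).1; have cpi j := (continuous_ReIm (cp j)).2.
have e2 : 0 < e / 2 by rewrite divr_gt0.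
have [d1 d10 h1] := uniform_taylor (r := r) dr cpr
  (fun j x xr => congr1 Re ((hr x xr).2 j)) e2.
have [d2 d20 h2] := uniform_taylor (r := r) di cpi
  (fun j x xr => congr1 Im ((hr x xr).2 j)) e2.
exists (Num.min d1 d2); first by rewrite lt_min d10.
move=> x y; rewrite lt_min => /andP[xy1 xy2].
rewrite (le_trans (normc_le_ReIm _))// [e]splitr mulrDl.
have reD (a b : R[i]) : Re (a - b) = Re a - Re b by case: a b => [? ?] [].
have imD (a b : R[i]) : Im (a - b) = Im a - Im b by case: a b => [? ?] [].
have reS (F : 'I_d -> R[i]) : Re (\sum_j F j) = \sum_j Re (F j).
  by apply: (big_morph Re) => // -[? ?] [].
have imS (F : 'I_d -> R[i]) : Im (\sum_j F j) = \sum_j Im (F j).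
  by apply: (big_morph Im) => // -[? ?] [].
rewrite lerD//.
- have := h1 x y xy1; rewrite !reD /grad_dot reS.
  by under [X in _ -> `|_ - X| <= _]eq_bigr do rewrite /= mulr0 subr0 mulrC.
- have := h2 x y xy2; rewrite !imD /grad_dot imS.
  by under [X in _ -> `|_ - X| <= _]eq_bigr do rewrite /= mulr0 add0r mulrC.
Qed.

End TestFunctions.

(** * A priori bounds on flows for small times *)

Section SmallTime.
Context {R : realType} {d : nat} {U : metricType R}.
Local Notation V := 'rV[R]_d.
Local Notation leb := (@completed_lebesgue_measure R).
Context {f : V * U -> V} {T m : R} (m0 : 0 < m)
  (fm : forall x u, `|frozen_field f u x| <= m * (1 + `|x|)).

Lemma between_in (a b s : R) : a \in `[0, T] -> b \in `[0, T] -> between a b s ->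
  s \in `[0, T].
Proof.
rewrite /between /= !in_itv/= minEle maxEle => /andP[? ?] /andP[? ?].
by case: (leP a b) => _ /= /andP[? ?]; apply/andP; split; lra.
Qed.

Lemma integrable_between (a b : R) h : a \in `[0, T] -> b \in `[0, T] ->
  leb.-integrable `[0, T] (EFin \o h) -> leb.-integrable (between a b) (EFin \o h).
Proof.
move=> /itvP a0 /itvP b0; apply: integrable_sub.
  by rewrite le_min a0 b0.
by rewrite ge_max a0 b0.
Qed.

Context {u : R -> U} {Phi : R -> R -> V -> V} (flow : controlled_flow f T u Phi).
Context {tau : R} (tau0 : tau \in `[0, T]).

(** Integrability of the velocity is part of the notion of flow, so the
    displacement is at most its L1 norm; this crude bound only serves to start
    the bootstrap of flow_radius. *)
Lemma flow_bounded x : exists M, forall s, s \in `[0, T] -> `|Phi tau s x| <= M.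
Proof.
have H j : exists M, forall s, s \in `[0, T] -> `|Phi tau s x 0 j| <= M.
  pose v s : R := frozen_field f (u s) (Phi tau s x) 0 j.
  exists (`|x 0 j| + \int[leb]_(s in `[0, T]) `|v s|) => s s0.
  have [_ /(_ x j) [iv ->]] := flow tau0 s0.
  rewrite (le_trans (ler_normD _ _))// lerD2l norm_oriented_integral.
  have ivb := integrable_between tau0 s0 iv.
  rewrite (le_trans (le_normr_Rintegral (measurable_lebR_itv _ _) ivb))//.
  have ivn := integrable_norm iv.
  apply: fine_le; [| |apply: ge0_subset_integral => //].
  - by have := integrable_fin_num (measurable_lebR_itv _ _) (integrable_norm ivb).
  - by have := integrable_fin_num (measurable_lebR_itv _ _) ivn.
  - exact: measurable_lebR_itv.
  - exact: measurable_lebR_itv.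
  - exact: (measurable_int leb ivn).
  - by move=> z; exact: between_in.
have /choice[M hM] := H; exists (\sum_j `|M j|) => s s0.
apply: norm_le_coord => [|j]; first exact: sumr_ge0.
rewrite (le_trans (hM j s s0))// (le_trans (ler_norm _))// (bigD1 j)//= lerDl.
exact: sumr_ge0.
Qed.

Lemma flow_displacement t x M : t \in `[0, T] ->
  (forall s, between tau t s -> `|Phi tau s x| <= M) ->
  `|Phi tau t x - x| <= m * (1 + M) * `|t - tau|.
Proof.
move=> t0 hM.
have M0 : 0 <= M.
  apply: le_trans (normr_ge0 _) (hM t _).
  by rewrite /between/= in_itv/= ge_min le_max lexx !orbT.
apply: norm_le_coord => [|j]; first by rewrite !mulr_ge0 ?addr_ge0// ltW.
have [_ /(_ x j) [iv E]] := flow tau0 t0.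
rewrite !mxE E addrC addKr; apply: le_oriented_integral_cst.
  exact: integrable_between.
move=> s st; rewrite (le_trans (coord_le_norm _ _))// (le_trans (fm _ _))//.
by rewrite ler_wpM2l ?(ltW m0)// lerD2l hM.
Qed.

Lemma between_trans (a b s r : R) : between a b s -> between a s r -> between a b r.
Proof.
rewrite /between /= !in_itv/= !minEle !maxEle.
case: (leP a b) => ab /= /andP[h1 h2]; case: (leP a s) => as_ /= /andP[h3 h4];
  by apply/andP; split; lra.
Qed.

(** A bootstrap in place of Gronwall's inequality: if the trajectory is
    bounded by M up to time t, the growth condition bounds every displacement
    from x by (1 + M) / 4, so the trajectory is bounded by N + (1 + M) / 2, N
    being its norm at time s0. Iterating halves the distance of M to the fixed
    point 2 N + 1. The choice s0 = tau bounds the trajectory by its starting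
    point, and s0 = t bounds it by its end point, which confines the points
    that the flow brings into a given ball. *)
Lemma flow_radius t x : t \in `[0, T] -> m * `|t - tau| <= 1 / 4 ->
  forall s0 s, between tau t s0 -> between tau t s ->
  `|Phi tau s x| <= 2 * `|Phi tau s0 x| + 1.
Proof.
move=> t0 mt s0 + bs0; pose K := 2 * `|Phi tau s0 x| + 1.
have [M hM] := flow_bounded x.
suff H n s : between tau t s -> `|Phi tau s x| <= K + `|M| / 2 ^+ n.
  by move=> s bs; apply: (@le_geometric _ _ _ `|M|) => n; exact: H.
elim: n s => [|n IH] s bs.
  rewrite expr0 divr1 (le_trans (hM s (between_in tau0 t0 bs)))//.
  by rewrite (le_trans (ler_norm _))// lerDr /K addr_ge0// mulr_ge0.
have disp r : between tau t r ->
    `|Phi tau r x - x| <= (1 + (K + `|M| / 2 ^+ n)) / 4.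
  move=> br; have r0 := between_in tau0 t0 br.
  have := @flow_displacement r x (K + `|M| / 2 ^+ n) r0.
  move=> /(_ (fun s bs => IH s (between_trans br bs))) /le_trans; apply.
  rewrite mulrAC mulrC ler_wpM2l//.
    by rewrite !addr_ge0// ?divr_ge0 ?exprn_ge0// mulr_ge0.
  rewrite div1r in mt; apply: le_trans mt; rewrite ler_wpM2l ?(ltW m0)//.
  exact: between_dist.
have d1 := disp s bs; have d2 := disp s0 bs0.
have : `|Phi tau s x| <= `|Phi tau s x - x| + `|Phi tau s0 x - x| + `|Phi tau s0 x|.
  have {1}-> : Phi tau s x = (Phi tau s x - x) - (Phi tau s0 x - x) + Phi tau s0 x.
    by rewrite opprB subrKA subrK.
  by rewrite (le_trans (ler_normD _ _))// lerD2r ler_normB.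
rewrite exprS invfM (mulrCA `|M|); move: d1 d2; rewrite /K.
by set a := `|M| / _; lra.
Qed.

Lemma flow_start x : Phi tau tau x = x.
Proof.
have [M hM] := flow_bounded x.
apply/eqP; rewrite -subr_eq0 -normr_le0.
rewrite (le_trans (@flow_displacement tau x M tau0 _))//.
  by move=> s bs; apply: hM; exact: between_in bs.
by rewrite subrr normr0 mulr0.
Qed.

End SmallTime.

(** * Averaging a control over a partition of time *)

Section LinearCombination.
Context {R : realType}.
Local Notation leb := (@completed_lebesgue_measure R).

Lemma oriented_integral_lincomb (a b : R) (I : Type) (r : seq I) (c : I -> R)
    (chi : I -> R -> R) :
  (forall k, leb.-integrable (between a b) (EFin \o chi k)) ->
  leb.-integrable (between a b) (EFin \o (fun s => \sum_(k <- r) c k * chi k s)) /\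
  oriented_integral a b (fun s => \sum_(k <- r) c k * chi k s) =
  \sum_(k <- r) c k * oriented_integral a b (chi k).
Proof.
move=> ichi; elim: r => [|k r [ir E]].
  rewrite big_nil (_ : (fun s => _) = cst 0); last by apply/funext => s;
    rewrite big_nil.
  split; first by apply: integrable_lebR; exact: cst_continuous.
  apply/eqP; rewrite -normr_le0 -[leRHS](mul0r `|b - a|);
    apply: le_oriented_integral_cst.
    by apply: integrable_lebR; exact: cst_continuous.
  by move=> s _; rewrite (_ : cst 0 s = 0)// normr0.
rewrite (_ : (fun s => _) = fun s => c k * chi k s + \sum_(k <- r) c k * chi k s);
  last first.
  by apply/funext => s; rewrite big_cons.
split; last by rewrite big_cons oriented_integral_lin// E.
exact: (integrableD (measurable_lebR_itv _ _) (integrableZl (measurable_lebR_itv _ _)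
  (c k) (ichi k)) ir).
Qed.

Lemma oriented_average_ge0 (a b : R) (h : R -> R) :
  (forall s, between a b s -> 0 <= h s) ->
  0 <= oriented_integral a b h / (b - a).
Proof.
move=> h0; rewrite oriented_integral_sgn mulrAC mulr_ge0//.
  have [ab|ab] := leP a b; first by rewrite expr0 mul1r invr_ge0 subr_ge0.
  by rewrite expr1 mulN1r oppr_ge0 invr_le0 subr_le0 ltW.
exact: Rintegral_ge0.
Qed.

Lemma oriented_integral_cst (a b c : R) : oriented_integral a b (cst c) = c * (b - a).
Proof.
rewrite /oriented_integral; case: leP => ab.
  by rewrite Rintegral_itv_cst.
by rewrite Rintegral_itv_cst ?ltW// -mulrN opprB.
Qed.

End LinearCombination.

Section KeyEstimate.
Context {R : realType} {d : nat} {U : metricType R}.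
Local Notation V := 'rV[R]_d.
Local Notation leb := (@completed_lebesgue_measure R).
Context {f : V * U -> V} {T tau : R} (tau0 : tau \in `[0, T])
  (f_growth : sublinear_growth f) (f_lip : locally_lipschitz f).

(** A subdivision of [0, T] into pieces on which u is nearly constant, in the
    sense of the fields on a ball. With a partition of unity in place of sets,
    the time spent in a piece is an integral, and linearity of the integral
    replaces additivity over the pieces. *)
Definition control_partition (r eta : R) (u : R -> U) n (p : 'I_n -> U)
    (chi : 'I_n -> R -> R) :=
  [/\ forall k, leb.-integrable `[0, T] (EFin \o chi k),
      forall k s, s \in `[0, T] -> 0 <= chi k s,
      forall s, s \in `[0, T] -> \sum_k chi k s = 1
    & forall k s x, s \in `[0, T] -> chi k s != 0 -> `|x| <= r ->
      `|frozen_field f (u s) x - frozen_field f (p k) x| <= eta].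

(** The mean value of chi between tau and t, for either orientation. *)
Definition weight (t : R) (chi : R -> R) := oriented_integral tau t chi / (t - tau).

Lemma sum_weight t r eta u n p (chi : 'I_n -> R -> R) : t \in `[0, T] -> t != tau ->
  control_partition r eta u p chi -> \sum_k weight t (chi k) = 1.
Proof.
move=> t0 tt [ichi _ chi1 _]; rewrite /weight -mulr_suml.
have [_ E] := @oriented_integral_lincomb R tau t _ (index_enum 'I_n) (fun=> 1) chi
  (fun k => integrable_between tau0 t0 (ichi k)).
rewrite (eq_bigr (fun k => 1 * oriented_integral tau t (chi k))); last by move=> k;
  rewrite mul1r.
rewrite -E (_ : oriented_integral _ _ _ = oriented_integral tau t (cst 1)).
  by rewrite oriented_integral_cst mul1r divff// subr_eq0.
rewrite !oriented_integral_sgn; congr (_ * _); apply: eq_Rintegral => s.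
rewrite inE => /(between_in tau0 t0) /chi1 chi1s; transitivity (\sum_k chi k s);
  last exact/esym.
by apply: eq_bigr => k _; rewrite mul1r.
Qed.

(** On the support of chi k, the velocity f (Phi tau s x, u s) is close to f
    (x, p k): the first argument moves by rho, costing L * rho, and the second
    costs eta. Integrating in time, the displacement is the average of the
    fields of p k with the weights of the chi k, uniformly in x. Averaging the
    velocities before testing them avoids exchanging the integrals over time
    and space. *)
Lemma average_displacement r rho eta L u (Phi : R -> R -> V -> V) n (p : 'I_n -> U)
    (chi : 'I_n -> R -> R) t x :
  controlled_flow f T u Phi -> control_partition r eta u p chi -> t \in `[0, T] ->
  t != tau -> 0 <= L -> 0 <= eta ->
  (forall u x y, `|x| <= r -> `|y| <= r ->
     `|frozen_field f u x - frozen_field f u y| <= L * `|x - y|) ->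
  `|x| <= r ->
  (forall s, between tau t s -> `|Phi tau s x| <= r /\ `|Phi tau s x - x| <= rho) ->
  `|Phi tau t x - x - (t - tau) *: \sum_k weight t (chi k) *: frozen_field f (p k) x|
    <= (L * rho + eta) * `|t - tau|.
Proof.
move=> flow [ichi chi0 chi1 chif] t0 tt L0 eta0 fL xr hs.
have rho0 : 0 <= rho.
  apply: le_trans (normr_ge0 _) (hs t _).2.
  by rewrite /between/= in_itv/= ge_min le_max lexx !orbT.
have ichi' k := integrable_between tau0 t0 (ichi k).
have bnd j s : between tau t s ->
    `|frozen_field f (u s) (Phi tau s x) 0 j -
      \sum_k (frozen_field f (p k) x 0 j) * chi k s| <= L * rho + eta.
  move=> bs; have s0 := between_in tau0 t0 bs; have [sr srho] := hs s bs.
  rewrite -[X in `|X - _|]mulr1 -(chi1 s s0) mulr_sumr -sumrB.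
  rewrite (le_trans (ler_norm_sum _ _ _))//.
  rewrite -[leRHS]mulr1 -(chi1 s s0) mulr_sumr; apply: ler_sum => k _.
  rewrite -mulrBl normrM (ger0_norm (chi0 k s s0)).
  have [->|c0] := eqVneq (chi k s) 0; first by rewrite !mulr0.
  rewrite ler_wpM2r ?chi0//.
  rewrite -(subrKA (frozen_field f (u s) x 0 j)) (le_trans (ler_normD _ _))// lerD//.
    have := coord_le_norm (frozen_field f (u s) (Phi tau s x) - frozen_field f (u s)
      x) j.
    rewrite !mxE => /le_trans; apply; rewrite (le_trans (fL _ _ _ sr xr))//.
    by rewrite ler_wpM2l.
  have := coord_le_norm (frozen_field f (u s) x - frozen_field f (p k) x) j.
  by rewrite !mxE => /le_trans; apply; exact: chif.
apply: norm_le_coord => [|j]; first by rewrite mulr_ge0// addr_ge0// mulr_ge0.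
have [_ /(_ x j) [iv E]] := flow tau t tau0 t0.
have ivb := integrable_between tau0 t0 iv.
have [il El] := @oriented_integral_lincomb R tau t _ (index_enum 'I_n)
  (fun k => frozen_field f (p k) x 0 j) chi ichi'.
pose v s : R := frozen_field f (u s) (Phi tau s x) 0 j.
pose h s := \sum_k (frozen_field f (p k) x 0 j) * chi k s.
have -> : (Phi tau t x - x -
      (t - tau) *: \sum_k weight t (chi k) *: frozen_field f (p k) x) 0 j =
        oriented_integral tau t (fun s => (-1) * h s + v s).
  rewrite oriented_integral_lin// El !mxE summxE E.
  have C (a b c : R) : a + b - a - c = - 1 * c + b by ring.
  rewrite C; congr (_ + _); congr (_ * _); rewrite mulr_sumr; apply: eq_bigr => k _;
    rewrite !mxE /weight.
  by field; rewrite subr_eq0.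
apply: le_oriented_integral_cst.
  exact: (integrableD (measurable_lebR_itv _ _) (integrableZl (measurable_lebR_itv _
    _) (-1) il) ivb).
by move=> s bs; rewrite mulN1r addrC; exact: bnd.
Qed.

(** A first-order expansion of phi along the averaged displacement. The
    estimate must be uniform over the whole space: if phi vanishes outside of
    the ball of radius r0, then for x outside of the ball of radius r1 = 2 r0
    + 1 the end point also lies outside of the first ball and everything
    vanishes, while for x in the ball of radius r1 the trajectory stays in the
    ball of radius r = 2 r1 + 1. *)
Lemma test_increment (phi : C1c R d) e : 0 < e ->
  exists r eta delta, [/\ 0 < eta, 0 < delta & forall t, t \in `[0, T] -> t != tau ->
    `|t - tau| < delta -> forall u Phi n (p : 'I_n -> U) chi,
    controlled_flow f T u Phi -> control_partition r eta u p chi -> forall x,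
    normc (phi (Phi tau t x) - phi x - (t - tau)%:C *
      \sum_k (weight t (chi k))%:C * grad_dot phi (frozen_field f (p k)) x)
    <= e * `|t - tau|].
Proof.
move=> e0; have [m m0 fm] := growth_max_norm f_growth.
have [r0 r00 hr0] := C1c_radius phi.
pose r1 := 2 * r0 + 1; pose r := 2 * r1 + 1.
have [L L0 fL] := lipschitz_max_norm f_lip r.
have r10 : 0 < r1 by rewrite /r1; lra.
have rr0 : 0 < r by rewrite /r; lra.
pose S := m * (1 + r); have S0 : 0 < S by rewrite mulr_gt0//; lra.
(* The 1 keeps the constant positive when phi vanishes or d = 0. *)
pose B := d%:R * C1norm phi + 1.
have B0 : 0 < B by rewrite /B ltr_wpDl// mulr_ge0// C1norm_ge0.
have e1 : 0 < e / (3 * S) by rewrite divr_gt0// mulr_gt0.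
have [dl dl0 htay] := C1c_taylor phi e1.
(* A third of the error goes to each of the Taylor remainder, the replacement
   of u s by p k, and the motion of the point along the flow. *)
pose eta := e / (3 * B); have eta0 : 0 < eta by rewrite divr_gt0// mulr_gt0.
pose delta := Num.min (Num.min (1 / (4 * m)) (dl / S)) (e / (3 * B * L * S)).
have delta0 : 0 < delta.
  rewrite !lt_min -andbA; apply/and3P.
  by split; apply: divr_gt0 => //; do ?[apply: mulr_gt0 => //].
exists r, eta, delta; split=> // t t0 tt td u Phi n p chi flow part x.
have [[tm tdl] te] : (`|t - tau| < 1 / (4 * m) /\ `|t - tau| < dl / S) /\
    `|t - tau| < e / (3 * B * L * S).
  by move: td; rewrite !lt_min => /andP[/andP[]].
have tau_tt : between tau t tau by rewrite /between/= in_itv/= ge_min le_max lexx.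
have t_tt : between tau t t by rewrite /between/= in_itv/= ge_min le_max lexx !orbT.
have mt : m * `|t - tau| <= 1 / 4.
  have := ltW tm; rewrite ler_pdivlMr ?mulr_gt0// => {}tm.
  rewrite ler_pdivlMr//; apply: le_trans tm.
  by rewrite le_eqVlt; apply/orP; left; apply/eqP; ring.
have rad := flow_radius m0 fm flow tau0 x t0 mt.
have [xr|xr] := leP `|x| r1; last first.
  have yr : r0 < `|Phi tau t x|.
    have := rad t tau t_tt tau_tt; rewrite (flow_start m0 fm flow tau0).
    by move: xr; rewrite /r1; lra.
  have xr' : r0 < `|x| by move: xr; rewrite /r1; lra.
  rewrite (hr0 _ yr).1 (hr0 _ xr').1 big1 ?mulr0 ?subr0 ?Normc.normc0 ?mulr_ge0//
    ?ltW//.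
  by move=> k _; rewrite /grad_dot big1 ?mulr0// => j _; rewrite (hr0 _ xr').2 mul0r.
have sr s : between tau t s -> `|Phi tau s x| <= r.
  move=> bs; have := rad tau s tau_tt bs; rewrite (flow_start m0 fm flow tau0).
  by move=> /le_trans; apply; rewrite /r lerD2r ler_wpM2l.
have disp s : between tau t s -> `|Phi tau s x - x| <= S * `|t - tau|.
  move=> bs; have s0 := between_in tau0 t0 bs.
  rewrite (le_trans (flow_displacement m0 fm flow tau0 s0 (M := r) _))//.
    by move=> q bq; apply: sr; exact: between_trans bs bq.
  by rewrite ler_wpM2l ?(ltW S0)// between_dist.
have xrr : `|x| <= r by apply: (le_trans xr); rewrite /r; lra.
have avg := average_displacement flow part t0 tt (ltW L0) (ltW eta0) fL xrr
  (fun s bs => conj (sr s bs) (disp s bs)).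
set A := \sum_k weight t (chi k) *: frozen_field f (p k) x in avg.
(* Linearity of the directional derivative separates the averaged field from
   the error in the displacement. *)
have GE : grad_dot phi (fun=> Phi tau t x - x - (t - tau) *: A) x =
    grad_dot phi (fun=> Phi tau t x - x) x - (t - tau)%:C *
      \sum_k (weight t (chi k))%:C * grad_dot phi (frozen_field f (p k)) x.
  rewrite (grad_dotB phi (fun=> Phi tau t x - x) (fun=> (t - tau) *: A)); congr (_ - _).
  rewrite -grad_dot_lincomb.
  have := grad_dot_lincomb phi (n := 1) (fun=> t - tau) (fun=> fun x => \sum_k weight
    t (chi k) *: frozen_field f (p k) x) x.
  by rewrite big_ord1 => <-; apply: eq_bigr => j _; rewrite big_ord1.
have -> : phi (Phi tau t x) - phi x - (t - tau)%:C *
      \sum_k (weight t (chi k))%:C * grad_dot phi (frozen_field f (p k)) x =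
   (phi (Phi tau t x) - phi x - grad_dot phi (fun=> Phi tau t x - x) x) +
   grad_dot phi (fun=> Phi tau t x - x - (t - tau) *: A) x.
  by rewrite GE addrA subrK.
rewrite (le_trans (le_normcD _ _))//.
have yx := disp t t_tt.
have T1 : normc (phi (Phi tau t x) - phi x - grad_dot phi (fun=> Phi tau t x - x) x)
    <= e / 3 * `|t - tau|.
  rewrite (le_trans (htay _ _ _))//.
    by rewrite (le_lt_trans yx)// mulrC -ltr_pdivlMr.
  rewrite (le_trans (ler_wpM2l (ltW e1) yx))// mulrA ler_wpM2r//.
  by rewrite le_eqVlt; apply/orP; left; apply/eqP; field; rewrite gt_eqF.
have T2 : normc (grad_dot phi (fun=> Phi tau t x - x - (t - tau) *: A) x)
    <= B * ((L * (S * `|t - tau|) + eta) * `|t - tau|).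
  rewrite (le_trans (le_grad_dot _ _ _))// ler_pM ?mulr_ge0 ?C1norm_ge0//.
  by rewrite /B lerDl.
rewrite (le_trans (lerD T1 T2))// mulrA -mulrDl ler_wpM2r//.
rewrite mulrDr (_ : B * eta = e / 3); last by rewrite /eta; field; rewrite gt_eqF.
have : B * (L * (S * `|t - tau|)) <= e / 3.
  have D0 : 0 < 3 * B * L * S by do ?[apply: mulr_gt0 => //].
  move: te; rewrite ltr_pdivlMr// => te.
  by rewrite ler_pdivlMr//; apply: le_trans (ltW te); rewrite le_eqVlt; apply/orP;
    left; apply/eqP; ring.
by lra.
Qed.

End KeyEstimate.
Arguments weight {R} tau t chi.
Arguments control_partition {R d U} f T r eta u {n} p chi.

(** * Difference quotients tested on finitely many functions *)

Section ComplexIntegral.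
Context {R : realType} {d : nat}.
Local Notation V := 'rV[R]_d.
Local Notation D := (C1c R d).
Implicit Types (z : V -> R[i]) (mu nu : cmeasure R d) (phi : D).

Lemma cbmeas_lin (a : R[i]) z1 z2 : cbmeas z1 -> cbmeas z2 ->
  cbmeas (fun x => a * z1 x + z2 x).
Proof.
move=> [r1 i1] [r2 i2]; case: a => p q; split.
  rewrite (_ : _ \o _ = fun x => p * (Re \o z1) x + ((- q) * (Im \o z1) x + (Re \o
    z2) x)).
    by apply: (@bmeas_lin _ _ (borel V)) => //; exact: (@bmeas_lin _ _ (borel V)).
  by apply/funext => x /=; case: (z1 x) (z2 x) => [? ?] [? ?] /=; rewrite mulNr addrA.
rewrite (_ : _ \o _ = fun x => p * (Im \o z1) x + (q * (Re \o z1) x + (Im \o z2) x)).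
  by apply: (@bmeas_lin _ _ (borel V)) => //; exact: (@bmeas_lin _ _ (borel V)).
by apply/funext => x /=; case: (z1 x) (z2 x) => [? ?] [? ?] /=; rewrite addrA.
Qed.

Lemma cbmeas0 : cbmeas (fun _ : V => 0 : R[i]).
Proof.
split; split; try exact: measurable_cst; by exists 0 => x; rewrite /= normr0.
Qed.

Lemma cintegral0 mu : cintegral mu (fun _ : V => 0 : R[i]) = 0.
Proof.
have := cintegral_lin mu (-1) cbmeas0 cbmeas0; rewrite mulr0 addr0 => E.
by rewrite E mulN1r addNr.
Qed.

Lemma cintegral_sum mu (I : Type) (r : seq I) (w : I -> R[i]) (z : I -> V -> R[i]) :
  (forall k, cbmeas (z k)) ->
  cbmeas (fun x => \sum_(k <- r) w k * z k x) /\
  cintegral mu (fun x => \sum_(k <- r) w k * z k x) =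
    \sum_(k <- r) w k * cintegral mu (z k).
Proof.
move=> bz; elim: r => [|k r [br E]].
  rewrite (_ : (fun x => _) = fun=> 0); last by apply/funext => x; rewrite big_nil.
  by rewrite big_nil cintegral0; split=> //; exact: cbmeas0.
rewrite (_ : (fun x => _) = fun x => w k * z k x + \sum_(k <- r) w k * z k x);
  last first.
  by apply/funext => x; rewrite big_cons.
by rewrite big_cons cintegral_lin// E; split=> //; exact: cbmeas_lin.
Qed.

Lemma cbmeas_C1c phi : cbmeas phi.
Proof.
have [cr ci] := C1c_continuous phi; apply: cbmeasP => //; exact: C1c_bounded.
Qed.

Lemma cbmeas_comp_continuous phi (g : V -> V) : continuous g -> cbmeas (phi \o g).
Proof.
move=> cg; have [cr ci] := C1c_continuous phi; apply: cbmeasP.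
- by move=> x; apply: (@continuous_comp _ _ _ g (Re \o phi)); [exact: cg|exact: cr].
- by move=> x; apply: (@continuous_comp _ _ _ g (Im \o phi)); [exact: cg|exact: ci].
- by have [c hc] := C1c_bounded phi; exists c => x; exact: hc.
Qed.

Lemma cbmeas_grad_dot phi (g : V -> V) : continuous g -> cbmeas (grad_dot phi g).
Proof.
move=> cg; have [cr ci] := grad_dot_continuous phi cg; apply: cbmeasP => //.
have [r r0 hr] := C1c_radius phi.
have /compact_bounded[M [_ hM]] : compact (g @` [set x | `|x| <= r]).
  by apply: continuous_compact; [exact: continuous_subspaceT|exact:
    compact_closed_ball].
exists (d%:R * C1norm phi * (`|M| + 1)) => x; have [xr|xr] := leP `|x| r.
  rewrite (le_trans (le_grad_dot _ _ _))// ler_wpM2l ?mulr_ge0 ?C1norm_ge0//.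
  by apply: (hM (`|M| + 1)); [rewrite (le_lt_trans (ler_norm _))// ltrDl|exists x].
rewrite /grad_dot big1 ?Normc.normc0.
  by rewrite !mulr_ge0 ?C1norm_ge0 ?addr_ge0.
by move=> j _; rewrite (hr x xr).2 mul0r.
Qed.

Lemma cintegral_pushforward mu nu (g : V -> V) phi : continuous g ->
  is_pushforward g mu nu -> cintegral nu phi = cintegral mu (phi \o g).
Proof.
move=> cg push; have mg := continuous_measurable_borel cg.
have [br bi] := cbmeas_C1c phi.
rewrite /cintegral.
have reE h : @bmeas R _ (borel V) h ->
    charge_integral (cmRe nu) h = charge_integral (cmRe mu) (h \o g).
  by apply: (charge_integral_pushforward mg) => B mB; case: (push B mB).
have imE h : @bmeas R _ (borel V) h ->
    charge_integral (cmIm nu) h = charge_integral (cmIm mu) (h \o g).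
  by apply: (charge_integral_pushforward mg) => B mB; case: (push B mB).
by rewrite !reE// !imE.
Qed.

Lemma cmass_ge0 mu : 0 <= cmass mu.
Proof.
by rewrite /cmass /charge_mass !addr_ge0// fine_ge0.
Qed.

End ComplexIntegral.

Section QuotientEstimate.
Context {R : realType} {d : nat} {U : metricType R}.
Local Notation V := 'rV[R]_d.
Local Notation D := (C1c R d).
Context {f : V * U -> V} {T tau : R} (tau0 : tau \in `[0, T])
  (f_growth : sublinear_growth f) (f_lip : locally_lipschitz f).
Implicit Types (mu nu : cmeasure R d) (phi : D).

(** The value at phi of the functional - div (f_u mu). *)
Definition field_pairing mu (u : U) phi : R[i] :=
  cintegral mu (grad_dot phi (frozen_field f u)).

(** Integrating the pointwise estimate against mu, whose total mass is finite.
    The weights depend neither on x nor on phi: the approximating functional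
    is a convex combination of the functionals of constant controls. *)
Lemma quotient_estimate mu phi (e : R) : 0 < e ->
  exists r eta delta, [/\ 0 < eta, 0 < delta & forall t, t \in `[0, T] -> t != tau ->
    `|t - tau| < delta -> forall u Phi n (p : 'I_n -> U) chi nu,
    controlled_flow f T u Phi -> control_partition f T r eta u p chi ->
    is_pushforward (Phi tau t) mu nu ->
    normc (((t - tau)^-1)%:C * (cintegral nu phi - cintegral mu phi) -
      \sum_k (weight tau t (chi k))%:C * field_pairing mu (p k) phi) <= e].
Proof.
move=> e0; have m0 := cmass_ge0 mu.
have e1 : 0 < e / (cmass mu *+ 2 + 1) by rewrite divr_gt0// ltr_wpDl// mulrn_wge0.
have [r [eta [delta [eta0 delta0 H]]]] := test_increment tau0 f_growth f_lip phi e1.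
exists r, eta, delta; split => // t t0 tt td u Phi n p chi nu flow part push.
have h := H t t0 tt td u Phi n p chi flow part.
have [cPhi _] := flow tau t tau0 t0.
rewrite (cintegral_pushforward _ cPhi push).
have bG k := cbmeas_grad_dot phi (@frozen_field_continuous _ _ _ _ f_lip (p k)).
have [bS ES] := cintegral_sum mu (index_enum 'I_n) (fun k => (weight tau t (chi
  k))%:C) bG.
have b1 := cbmeas_comp_continuous phi cPhi; have b2 := cbmeas_C1c phi.
have b3 := cbmeas_lin (-1) b2 b1.
have b4 := cbmeas_lin (- (t - tau)%:C) bS b3.
have := le_cintegral mu b4 (c := e / (cmass mu *+ 2 + 1) * `|t - tau|).
rewrite (cintegral_lin _ _ bS b3) (cintegral_lin _ _ b2 b1) ES => h4.
have tt0 : t - tau != 0 by rewrite subr_eq0.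
have ttC : (t - tau)%:C != 0 :> R[i] by rewrite eq_complex /= negb_and tt0.
set q := \sum_k _ in h4 *; set a := cintegral mu _ in h4 *;
  set b := cintegral mu _ in h4 *.
have -> : ((t - tau)^-1)%:C * (b - a) - q =
    ((t - tau)^-1)%:C * (- (t - tau)%:C * q + (-1 * a + b)).
  have Xc : ((t - tau)^-1)%:C * (t - tau)%:C = 1 :> R[i] by rewrite -rmorphM mulVf.
  by rewrite [RHS]mulrDr mulrA mulrN Xc !mulN1r addrC (addrC (- a)).
rewrite Normc.normcM normc_real normfV ler_pdivrMl ?normr_gt0//.
apply: le_trans (h4 _) _.
  move=> x; rewrite (le_trans _ (h x))// le_eqVlt; apply/orP; left; apply/eqP.
  by congr (normc _); rewrite mulN1r mulNr addrC (addrC (- _)).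
rewrite mulrC mulrA [leLHS]mulrC ler_wpM2l// mulrA ler_pdivrMr;
  last by rewrite ltr_wpDl// mulrn_wge0.
by rewrite mulrC ler_wpM2l ?(ltW e0)// lerDl.
Qed.

Lemma control_partition_le r r' eta eta' u n (p : 'I_n -> U) chi :
  r' <= r -> eta <= eta' -> control_partition f T r eta u p chi ->
  control_partition f T r' eta' u p chi.
Proof.
move=> rr ee [c1 c2 c3 c4]; split => // k s x s0 c0 xr.
by rewrite (le_trans (c4 k s x s0 c0 _))// (le_trans xr).
Qed.

(** A weak-star neighbourhood constrains finitely many test functions, so the
    scales of the individual estimates can be taken uniform over a list. *)
Lemma quotient_estimate_seq mu (s : seq D) (e : R) : 0 < e ->
  exists r eta delta, [/\ 0 < eta, 0 < delta & forall t, t \in `[0, T] -> t != tau ->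
    `|t - tau| < delta -> forall u Phi n (p : 'I_n -> U) chi nu,
    controlled_flow f T u Phi -> control_partition f T r eta u p chi ->
    is_pushforward (Phi tau t) mu nu -> forall phi, phi \in s ->
    normc (((t - tau)^-1)%:C * (cintegral nu phi - cintegral mu phi) -
      \sum_k (weight tau t (chi k))%:C * field_pairing mu (p k) phi) <= e].
Proof.
move=> e0; elim: s => [|phi s [r1 [eta1 [del1 [eta10 del10 h1]]]]].
  by exists 0, 1, 1; split.
have [r2 [eta2 [del2 [eta20 del20 h2]]]] := quotient_estimate mu phi e0.
exists (Num.max r1 r2), (Num.min eta1 eta2), (Num.min del1 del2).
rewrite !lt_min eta10 eta20 del10 del20; split => // t t0 tt.
rewrite lt_min => /andP[td1 td2] u Phi n p chi nu flow part push psi.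
rewrite inE => /predU1P[->|psis].
  apply: (h2 t t0 tt td2 u Phi n p chi nu flow _ push);
    apply: (control_partition_le _ _ part).
    by rewrite le_max lexx orbT.
  by rewrite ge_min lexx orbT.
apply: (h1 t t0 tt td1 u Phi n p chi nu flow _ push) => //.
apply: (control_partition_le _ _ part).
  by rewrite le_max lexx.
by rewrite ge_min lexx.
Qed.

End QuotientEstimate.

(** * Neighbourhoods in the weak-star topology *)

Section WeakStar.
Context {R : realType} {d : nat}.
Local Notation D := (C1c R d).
Local Notation E := (C1c_dual R d).
Implicit Types (l nu : E) (phi : D) (s : seq D) (e : R).

Definition basic_nbhs nu s e : set E :=
  [set l | forall phi, phi \in s -> normc (l phi - nu phi) < e].

(** The index type carries no topology, so convergence is checked through the
    initial topologies of the evaluations, of which the pointwise topology is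
    the supremum. *)
Lemma ptws_cvg (X : Type) (W : topologicalType) (F : set_system (X -> W)) (g : X -> W) :
  Filter F -> (forall t, (fun h => h t) @ F --> g t) -> F --> (g : {ptws X -> W}).
Proof.
move=> FF H; apply/cvg_sup => i; apply/cvg_image.
  by rewrite eqEsubset; split=> v // _; exists (cst v).
move=> A /H FA; exists ((fun h : X -> W => h i) @^-1` A); first exact: FA.
by rewrite eqEsubset; split => [j [? + <-//]|j Wj]; exists (fun _ => j).
Qed.

Lemma eval_continuous phi : continuous (fun l : E => (l : D -> R[i]) phi : R[i]^o).
Proof.
move=> l; apply: (@continuous_comp E {ptws D -> R[i]^o} R[i]^o
  (@dual_fun R d) (fun h => h phi)).
  exact: initial_continuous.
exact: (@proj_continuous D (fun=> R[i]^o) phi).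
Qed.

Lemma basic_nbhs_nbhs nu s e : 0 < e -> nbhs nu (basic_nbhs nu s e).
Proof.
move=> e0; elim: s => [|phi s IH]; first by apply: filterS filterT => l _ psi.
have H : nbhs nu [set l : E | normc (l phi - nu phi) < e].
  have e0' : (0 : R[i]) < e%:C by rewrite ltcR.
  have : nbhs nu [set l : E | `|(nu phi : R[i]^o) - (l phi : R[i]^o)| < e%:C].
    exact: (@cvgrPdist_lt _ _ _ (nbhs nu) _ (fun l : E => (l : D -> R[i]) phi :
      R[i]^o) (nu phi)).1 (@eval_continuous phi nu) _ e0'.
  apply: (@filterS _ (nbhs nu)) => l.
  rewrite /= distrC normc_def -ltcR; by case: (l phi - nu phi).
apply: filterS (filterI H IH) => l [/= h1 h2] psi.
by rewrite inE => /predU1P[->//|]; exact: h2.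
Qed.

Lemma nbhs_basic_nbhs nu (N : set E) : nbhs nu N ->
  exists s e, 0 < e /\ basic_nbhs nu s e `<=` N.
Proof.
move=> [_ [[Q oQ <-] Qnu QN]].
pose basic (se : seq D * R) := [set h : D -> R[i] |
  forall phi, phi \in se.1 -> normc (h phi - nu phi) < se.2].
pose G : set_system (D -> R[i]^o) := filter_from [set se : seq D * R | 0 < se.2] basic.
have FG : Filter G.
  apply: filter_from_filter; first by exists ([::], 1) => /=.
  move=> [s1 e1] [s2 e2] /= e10 e20; exists (s1 ++ s2, Num.min e1 e2) => /=.
    by rewrite lt_min e10.
  move=> h /= hb; split => phi /= ps; have := hb phi;
    rewrite mem_cat ps ?orbT => /(_ isT);
    by rewrite lt_min => /andP[].
have : G --> (dual_fun nu : {ptws D -> R[i]^o}).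
  apply: ptws_cvg => phi; apply/cvgrPdist_lt => e e0.
  have eR : e = (Re e)%:C by case: e e0 => a b; rewrite ltcE /= => /andP[/eqP ->].
  exists ([:: phi], Re e) => /=; first by move: e0; rewrite eR ltcR.
  move=> h /(_ phi); rewrite inE eqxx => /(_ isT) /= hb.
  rewrite distrC eR normc_def; move: hb; rewrite -ltcR; by case: (h phi - nu phi).
have nQ : nbhs (dual_fun nu : {ptws D -> R[i]^o}) Q by apply: open_nbhs_nbhs.
move=> /(_ Q nQ)[[s e] /= e0 sQ].
by exists s, e; split=> // l lb; apply: QN; apply: sQ.
Qed.

End WeakStar.

(** * Convex combinations and partitions adapted to a control *)

Section ConvexCombination.
Context {K : numFieldType} {M : lmodType K} (A : set (convex_lmodType M)).

(** States convexity with a scalar of the field rather than with a point of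
    its unit interval. *)
Lemma convex_setP : convex_set A <->
  forall (x y : M) (t : K), 0 <= t -> t <= 1 -> A x -> A y -> A (t *: x + (1 - t) *: y).
Proof.
split=> [cA x y t t0 t1 Ax Ay|cA x y t].
  by have := cA x y (Itv01 t0 t1); rewrite !inE => /(_ Ax Ay).
by rewrite !inE => Ax Ay; apply: cA => //; exact: ge0 || exact: le1.
Qed.

(** Adding one point at a time, after normalizing the weights already used;
    the case of a vanishing partial sum is separate because it cannot be
    normalized. *)
Lemma convex_sum n (w : 'I_n -> K) (x : 'I_n -> M) : convex_set A ->
  (forall k, 0 <= w k) -> \sum_k w k = 1 -> (forall k, A (x k)) ->
  A (\sum_k w k *: x k).
Proof.
move=> /convex_setP cA w0 w1 xA.
suff H W : 0 < W -> \sum_k w k = W -> A (W^-1 *: \sum_k w k *: x k).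
  by have := H 1 ltr01 w1; rewrite invr1 scale1r.
elim: n w x w0 {w1} xA W => [|n IH] w x w0 xA W W0.
  by rewrite big_ord0 => W00; rewrite -W00 ltxx in W0.
rewrite !big_ord_recr/=; set S := \sum_(i < n) _; set wn := w ord_max => SW.
have S0 : 0 <= S by apply: sumr_ge0 => i _.
have [S00|Sn0] := eqVneq S 0.
  have w00 := (psumr_eq0P (fun i _ => w0 (widen_ord (leqnSn n) i)) S00).
  rewrite big1; last by move=> i _; rewrite w00// scale0r.
  by rewrite S00 add0r in SW; rewrite add0r scalerA -SW mulVf ?scale1r// SW gt_eqF.
have Sp : 0 < S by rewrite lt_neqAle eq_sym Sn0.
have h := IH (fun i => w (widen_ord (leqnSn n) i)) (fun i => x (widen_ord (leqnSn n) i))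
  (fun i => w0 _) (fun i => xA _) S Sp erefl.
have := cA _ _ (S / W) _ _ h (xA ord_max).
rewrite divr_ge0 ?(ltW W0)// ler_pdivrMr// mul1r -{1}SW lerDl w0 => /(_ isT isT).
rewrite scalerA mulrAC mulfV// mul1r scalerDr scalerA.
rewrite (_ : 1 - S / W = W^-1 * wn)//.
by rewrite -{1}(mulfV (lt0r_neq0 W0)) -mulrBl -{1}SW [S + wn]addrC addrK mulrC.
Qed.

End ConvexCombination.

Section Continuity.
Context {R : realType} {d : nat} {U : metricType R}.
Local Notation V := 'rV[R]_d.
Local Notation lebR := (caratheodory_type (@wlength R idfun)^*%mu).
Context {f : V * U -> V} (cf : continuous f) (cU : compact [set: U]).

(** Compactness of the ball makes the continuity of f in the control uniform
    in x. *)
Lemma frozen_field_near r e u : 0 < e ->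
  \forall v \near u, forall x, `|x| <= r ->
    `|frozen_field f v x - frozen_field f u x| < e.
Proof.
move=> e0; have /compact_near_coveringP nc := @compact_closed_ball R d r.
apply: (nc U (nbhs u) (fun v x => `|frozen_field f v x - frozen_field f u x| < e)).
move=> x _; have e2 : 0 < e / 2 by rewrite divr_gt0.
have /(@cvgrPdist_lt _ _ _ (nbhs (x, u)))/(_ _ e2)[[A B] /= [nA nB] AB] := @cf (x, u).
exists (A, B) => //= -[x' v] /= [Ax' Bv].
have h1 := AB (x', v) (conj Ax' Bv).
have h2 := AB (x', u) (conj Ax' (nbhs_singleton nB)).
rewrite /frozen_field -(subrKA (f (x, u))) (le_lt_trans (ler_normD _ _))//.
by rewrite [e]splitr ltrD// distrC.
Qed.

(** By compactness finitely many controls p k represent all controls up to eta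
    on the ball of radius r; each time is assigned to the first p k that
    represents u s, so that the sets of times are obtained from preimages of
    open sets by complements and finite intersections. *)
Lemma control_partition_exists T r eta u : 0 < eta -> control T u ->
  exists n (p : 'I_n -> U) chi, control_partition f T r eta u p chi.
Proof.
move=> eta0 mu.
pose W v : set U := interior [set v' | forall x, `|x| <= r ->
  `|frozen_field f v' x - frozen_field f v x| < eta].
have [q cq] : exists q : seq U, forall v, exists2 a, a \in q & W a v.
  have /compact_near_coveringP nc := cU.
  pose G : set_system (seq U) := filter_from setT
    (fun s0 : seq U => [set s : seq U | {subset s0 <= s}]).
  have FG : Filter G.
    apply: filter_from_filter; first by exists [::].
    move=> s1 s2 _ _; exists (s1 ++ s2) => // s /= hs; split => a ha; apply: hs;
      by rewrite mem_cat ha ?orbT.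
  have [|s _ hs] := nc _ G (fun s v => exists2 a, a \in s & W a v) FG.
    move=> v _; exists (W v, [set s : seq U | {subset [:: v] <= s}]) => /=.
      split; last by exists [:: v].
      by apply: open_nbhs_nbhs; split; [exact: open_interior|exact: frozen_field_near].
    by move=> [v' s] [/= Wv' vs]; exists v => //; apply: vs; rewrite inE.
  by exists s => v; apply: (hs s).
pose kap v := find (fun a => v \in W a) q.
have kapP v : (kap v < size q)%N.
  rewrite -has_find; apply/hasP; have [a aq Wa] := cq v.
  by exists a => //; rewrite inE.
pose A (k : nat) := `[0, T]%classic `&` [set s | kap (u s) = k].
have mA (k : 'I_(size q)) : measurable (A k : set lebR).
  pose P j : set lebR := `[0, T] `&` u @^-1` (W (nth (tnth (in_tuple q) k) q j)).
  have mP j : measurable (P j).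
    by apply: mu; apply: sub_sigma_algebra; exact: open_interior.
  rewrite (_ : A k = P k `&` \bigcap_(j in `I_k) ~` P j).
    apply: measurableI => //; apply: fin_bigcap_measurable => // j _.
    exact: measurableC.
  apply/seteqP; split=> [s' [s0 /= kE]|s' [[s0 Wk] hk]].
    have hq : has (fun a => u s' \in W a) q by rewrite has_find kapP.
    split; first by split => //; have := nth_find (tnth (in_tuple q) k) hq;
      rewrite inE -/(kap _) kE.
    move=> j jk [_]; have := @before_find _ (tnth (in_tuple q) k) (fun a => u s' \in
      W a) q j.
    by rewrite -/(kap _) kE => /(_ jk) /negbT; rewrite notin_setE.
  split => //=; have hq : has (fun a => u s' \in W a) q by rewrite has_find kapP.
  have [kk|kk|//] := ltngtP (kap (u s')) k.
    have := nth_find (tnth (in_tuple q) k) hq; rewrite inE -/(kap _) => Wj.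
    by have := hk _ kk; case; split.
  have := @before_find _ (tnth (in_tuple q) k) (fun a => u s' \in W a) q k kk.
  by move=> /negbT; rewrite notin_setE.
exists (size q), (tnth (in_tuple q)), (fun k => \1_(A k)).
have chiE s' (k : 'I_(size q)) : s' \in `[0, T] -> \1_(A k) s' = (kap (u s') == k)%:R
  :> R.
  move=> s0; rewrite indicE; congr (_ %:R); congr nat_of_bool.
  by apply/idP/eqP => [|kE]; rewrite inE => //; case.
split.
- move=> k; apply: measurable_bounded_integrable.
  + exact: measurable_lebR_itv.
  + have [ab|ba] := leP 0 T; first by rewrite [X in (X < _)%E](completed_lebesgue_itv
      ab) ltry.
    by rewrite set_itv_ge ?measure0// -leNgt bnd_simp.
  + by apply: measurable_funTS; exact: measurable_indic.
  + exists 1; split; first exact: num_real.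
    by move=> M M1 s' _; rewrite /= indicE normr_nat (le_trans _ (ltW M1))// lern1
      leq_b1.
- by move=> k s' s0; rewrite chiE.
- move=> s' s0; under eq_bigr do rewrite chiE//.
  rewrite (bigD1 (Ordinal (kapP (u s'))))//= eqxx big1 ?addr0// => k.
  by rewrite eq_sym -val_eqE /= => /negbTE ->.
- move=> k s' x s0; rewrite chiE// pnatr_eq0 eqb0 negbK => /eqP kE xr.
  have hq : has (fun a => u s' \in W a) q by rewrite has_find kapP.
  have := nth_find (tnth (in_tuple q) k) hq; rewrite -/(kap _) kE inE.
  rewrite -[nth _ _ _](tnth_nth _ (in_tuple q)).
  by move=> /interior_subset /(_ x xr) /ltW.
Qed.

End Continuity.

(** * Compact families of functionals and support functions *)

Section DualElements.
Context {R : realType} {d : nat}.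
Local Notation D := (C1c R d).
Local Notation E := (C1c_dual R d).

Lemma dual_ext (l1 l2 : E) : (forall phi, l1 phi = l2 phi) -> l1 = l2.
Proof. by move=> l12; apply: val_inj; apply/funext. Qed.

Lemma dual_linear (l : E) (a : R[i]) (phi psi : D) :
  l (a *: phi + psi) = a * l phi + l psi.
Proof. by have /dualP[lin _] := dual_funP l; exact: lin. Qed.

Lemma dual0 (l : E) : l 0 = 0.
Proof. by have := dual_linear l (-1) 0 0; rewrite scaler0 addr0 mulN1r addNr. Qed.

Lemma dual_sum (l : E) (s : seq D) (c : D -> R[i]) :
  l (\sum_(phi <- s) c phi *: phi) = \sum_(phi <- s) c phi * l phi.
Proof.
elim: s => [|phi s IH]; first by rewrite !big_nil dual0.
by rewrite !big_cons dual_linear IH.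
Qed.

Lemma dual_scaleE (a : R[i]) (l : E) phi : (a *: l : E) phi = a * l phi.
Proof. by []. Qed.

Lemma dual_addE (l1 l2 : E) phi : (l1 + l2 : E) phi = l1 phi + l2 phi.
Proof. by []. Qed.

Lemma dual_oppE (l : E) phi : (- l : E) phi = - l phi.
Proof. by []. Qed.

Lemma dual_sumE (I : Type) (r : seq I) (l : I -> E) phi :
  (\sum_(k <- r) l k : E) phi = \sum_(k <- r) l k phi.
Proof. by elim: r => [|k r IH]; rewrite ?big_nil// !big_cons dual_addE IH. Qed.

End DualElements.

Section CompactFamily.
Context {R : realType} {d : nat} {U : topologicalType}.
Local Notation D := (C1c R d).
Local Notation E := (C1c_dual R d).
Context (cU : compact [set: U]) {sigma : U -> E}
  (sigma_near : forall phi u (e : R), 0 < e ->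
     \forall v \near u, normc (sigma v phi - sigma u phi) < e).

(** The sets of indices whose functional is close to nu on finitely many test
    functions generate a proper filter; at a cluster point of this filter the
    functional equals nu. *)
Lemma range_of_approx (nu : E) :
  (forall (s : seq D) (e : R), 0 < e -> exists u, forall phi, phi \in s ->
    normc (sigma u phi - nu phi) < e) ->
  exists u, nu = sigma u.
Proof.
move=> approx.
pose near_nu (se : seq D * R) := [set u | forall phi, phi \in se.1 ->
    normc (sigma u phi - nu phi) < se.2].
pose G : set_system U := filter_from [set se : seq D * R | 0 < se.2] near_nu.
have PG : ProperFilter G.
  apply: filter_from_proper; last by move=> [s e] /= /(approx s).
  apply: filter_from_filter; first by exists ([::], 1) => /=.
  move=> [s1 e1] [s2 e2] /= e10 e20; exists (s1 ++ s2, Num.min e1 e2) => /=.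
    by rewrite lt_min e10.
  move=> u hu; split => phi /= ps; have := hu phi; rewrite mem_cat ps ?orbT => /(_ isT);
    by rewrite lt_min => /andP[].
have [|u [_ uG]] := cU PG; first exact: filterT.
exists u; apply: dual_ext => phi; apply/eqP; rewrite eq_sym -subr_eq0; apply/eqP.
apply: Normc.eq0_normc; apply/eqP; rewrite eq_le normc_ge0 andbT.
apply/ler_addgt0Pr => e e0; rewrite add0r.
have e2 : 0 < e / 2 by rewrite divr_gt0.
have Gphi : G [set v | normc (sigma v phi - nu phi) < e / 2].
  by exists ([:: phi], e / 2) => // v /=; apply; rewrite inE.
have [v [/= v1 v2]] := uG _ _ Gphi (sigma_near phi u e2).
rewrite -(subrKA (sigma v phi)) (le_trans (le_normcD _ _))//.
rewrite [e]splitr lerD//; last exact: ltW.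
by rewrite -opprB normcN ltW.
Qed.

Lemma ReIm_family_continuous phi :
  continuous (fun u => Re (sigma u phi)) /\
  continuous (fun u => Im (sigma u phi)).
Proof.
have reB (a b : R[i]) : Re (a - b) = Re a - Re b by case: a b => [? ?] [].
have imB (a b : R[i]) : Im (a - b) = Im a - Im b by case: a b => [? ?] [].
split=> u; apply/(@cvgrPdist_lt _ _ _ (nbhs u)) => e e0;
  have := sigma_near phi u e0; apply: filterS => v hv; rewrite distrC.
  by rewrite -reB (le_lt_trans (normr_Re _)).
by rewrite -imB (le_lt_trans (normr_Im _)).
Qed.

(** The first-order condition at a minimum: a quadratic t Q - 2 P that is
    nonnegative for small t > 0 has P <= 0. *)
Lemma quadratic_le0 (P Q : R) : 0 <= Q ->
  (forall t, 0 < t -> t <= 1 -> 2 * P <= t * Q) -> P <= 0.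
Proof.
move=> Q0 H; rewrite leNgt; apply/negP => P0.
have PQ : 0 < P + Q by rewrite ltr_wpDr.
have := H (P / (P + Q)); rewrite divr_gt0// ler_pdivrMr// mul1r lerDl Q0 => /(_ isT
  isT).
rewrite mulrAC ler_pdivlMr// => h.
by have := mulr_gt0 P0 P0; have := mulr_ge0 (ltW P0) Q0; lra.
Qed.

(** The real inner product of the complex plane; real parts of pairings and
    squared moduli are both expressed with it. *)
Definition rdot (a b : R[i]) : R := Re a * Re b + Im a * Im b.

Lemma normc_sqr (z : R[i]) : normc z ^+ 2 = rdot z z.
Proof. by case: z => a b /=; rewrite sqr_sqrtr ?addr_ge0 ?sqr_ge0// /rdot/= !expr2. Qed.

Lemma rdotBr (a b c : R[i]) : rdot a (b - c) = rdot a b - rdot a c.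
Proof. by case: a b c => [? ?] [? ?] [? ?]; rewrite /rdot/=; ring. Qed.

Lemma rdot_ge0 (a : R[i]) : 0 <= rdot a a.
Proof. by rewrite /rdot -!expr2 addr_ge0// sqr_ge0. Qed.

Lemma Re_dual_sum (l : E) (s : seq D) (a : D -> R[i]) :
  Re (l (\sum_(phi <- s) (a phi)^* *: phi)) = \sum_(phi <- s) rdot (a phi) (l phi).
Proof.
rewrite dual_sum; have -> : forall F : D -> R[i], Re (\sum_(phi <- s) F phi) =
    \sum_(phi <- s) Re (F phi) by move=> F; apply: (big_morph Re) => // -[? ?] [].
apply: eq_bigr => phi _; rewrite /rdot; case: (a phi) (l phi) => [p q] [p' q'] /=.
by rewrite mulNr opprK.
Qed.

Lemma energy_continuous (nu : E) (s : seq D) : continuous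
  (fun u => \sum_(phi <- s) rdot (sigma u phi - nu phi) (sigma u phi - nu phi)).
Proof.
have reB (a b : R[i]) : Re (a - b) = Re a - Re b by case: a b => [? ?] [].
have imB (a b : R[i]) : Im (a - b) = Im a - Im b by case: a b => [? ?] [].
elim: s => [|phi s IH] u.
  rewrite (_ : (fun u => _) = cst 0); first exact: cst_continuous.
  by apply/funext => v; rewrite big_nil.
rewrite (_ : (fun u => _) = fun u => ((Re (sigma u phi) - Re (nu phi)) *
   (Re (sigma u phi) - Re (nu phi)) + (Im (sigma u phi) - Im (nu phi)) *
   (Im (sigma u phi) - Im (nu phi))) +
  \sum_(phi <- s) rdot (sigma u phi - nu phi) (sigma u phi - nu phi)); last first.
  by apply/funext => v; rewrite big_cons /rdot !reB !imB.
have [cr ci] := ReIm_family_continuous phi.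
have sq (h : U -> R) c : continuous h -> continuous (fun u => (h u - c) * (h u - c)).
  move=> ch v; have hB : h w - c @[w --> v] --> h v - c.
    by apply: (@cvgB R R^o U (nbhs v)); [exact: ch|exact: cvg_cst].
  exact: (@cvgM R U (nbhs v) _ _ _ _ _ hB hB).
apply: (@cvgD R R^o); last exact: IH.
by apply: (@cvgD R R^o); apply: sq.
Qed.

(** Hahn-Banach separation in finite dimension, done by hand. Let sigma u0
    minimize the squared distance to nu over the test functions of the list,
    and let a be the error. Moving from u0 towards any u along a segment,
    which convexity allows, shows that the pairing of a with sigma u - sigma
    u0 is nonpositive. Hence on the test function psi = sum (a phi)^* phi the
    family is bounded by its value at u0, and so is nu; the difference of the
    two is the squared error, which must vanish. *)
Lemma support_approx (nu : E) :
  (forall u v (t : R), 0 <= t -> t <= 1 -> exists w, forall phi,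
     sigma w phi = t%:C * sigma u phi + (1 - t)%:C * sigma v phi) ->
  (forall phi,
     ((Re (nu phi))%:E <= ereal_sup [set (Re (sigma u phi))%:E | u in setT])%E) ->
  forall (s : seq D) (e : R), 0 < e ->
  exists u, forall phi, phi \in s -> normc (sigma u phi - nu phi) < e.
Proof.
move=> sigma_convex adj s e e0.
(* Without controls the supremum is - oo, which the value 0 at the test
   function 0 exceeds. *)
have U0 : [set: U] !=set0.
  apply/set0P/eqP => U0; have := adj 0; rewrite U0 image_set0 ereal_sup0.
  by rewrite leeNy_eq.
pose energy u := \sum_(phi <- s) rdot (sigma u phi - nu phi) (sigma u phi - nu phi).
have [u0 _ min0] : exists2 u0, u0 \in [set: U] &
    forall u, u \in [set: U] -> energy u0 <= energy u.
  apply: compact_EVT_min => //; apply: continuous_subspaceT.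
  exact: energy_continuous.
pose a phi := nu phi - sigma u0 phi.
have P0 u : \sum_(phi <- s) rdot (a phi) (sigma u phi - sigma u0 phi) <= 0.
  set b := fun phi => sigma u phi - sigma u0 phi.
  apply: (@quadratic_le0 _ (\sum_(phi <- s) rdot (b phi) (b phi))).
    by apply: sumr_ge0 => phi _; exact: rdot_ge0.
  move=> t t0 t1; have [w wE] := sigma_convex u u0 t (ltW t0) t1.
  have := min0 w; rewrite inE => /(_ I).
  have -> : energy w = energy u0 + t * (t * (\sum_(phi <- s) rdot (b phi) (b phi))
      - 2 * \sum_(phi <- s) rdot (a phi) (b phi)).
    rewrite /energy !mulr_sumr -sumrB mulr_sumr -big_split; apply: eq_bigr => phi _.
    rewrite wE /a /b; case: (sigma u phi) (sigma u0 phi) (nu phi) => [? ?] [? ?] [? ?].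
    by rewrite /rdot/=; ring.
  by rewrite lerDl pmulr_rge0// subr_ge0.
have E0 : energy u0 <= 0.
  have := adj (\sum_(phi <- s) (a phi)^* *: phi).
  set c := Re (sigma u0 (\sum_(phi <- s) (a phi)^* *: phi)).
  have supc : (ereal_sup [set (Re (sigma u (\sum_(phi <- s) (a phi)^* *: phi)))%:E |
    u in setT]
      <= c%:E)%E.
    apply: ge_ereal_sup => _ [u _ <-]; rewrite lee_fin -subr_le0 /c !Re_dual_sum -sumrB.
    by have := P0 u; under eq_bigr do rewrite rdotBr.
  move=> /le_trans/(_ supc); rewrite lee_fin -subr_le0 /c !Re_dual_sum -sumrB.
  apply: le_trans; rewrite le_eqVlt; apply/orP; left; apply/eqP.
  apply: eq_bigr => phi _; rewrite -rdotBr /a.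
  by case: (sigma u0 phi) (nu phi) => [? ?] [? ?]; rewrite /rdot/=; ring.
exists u0 => phi phis; rewrite -(ltr_pXn2r (n := 2))// ?nnegrE ?normc_ge0 ?(ltW e0)//.
rewrite (@le_lt_trans _ _ 0)// ?exprn_gt0// normc_sqr.
apply: le_trans E0; rewrite /energy (big_rem phi)//= lerDl.
by apply: sumr_ge0 => psi _; exact: rdot_ge0.
Qed.

End CompactFamily.

Section Transport.
Context {R : realType} {d : nat} {U : metricType R}.
Local Notation V := 'rV[R]_d.
Local Notation D := (C1c R d).
Local Notation E := (C1c_dual R d).
Context {f : V * U -> V} (cf : continuous f) (f_lip : locally_lipschitz f).
Implicit Types (mu nu : cmeasure R d) (phi : D) (u v : U).

(** Kept opaque below, because unfolding it makes the unification of pairings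
    costly. *)
Definition minus_divergence mu u : E := - divergence (frozen_field f u) mu.

Lemma minus_divergenceE mu u phi :
  minus_divergence mu u phi = field_pairing (f := f) mu u phi.
Proof.
rewrite /minus_divergence dual_oppE divergenceE ?opprK//.
exact: (frozen_field_continuous f_lip).
Qed.

Lemma minus_divergencesE mu : minus_divergences f mu = range (minus_divergence mu).
Proof. by []. Qed.

#[local] Opaque minus_divergence.

(** The gradient of phi vanishes outside of a ball, on which the fields of
    nearby controls are uniformly close. *)
Lemma minus_divergence_near mu phi u (e : R) : 0 < e -> \forall v \near u,
  normc (minus_divergence mu v phi - minus_divergence mu u phi) < e.
Proof.
move=> e0; have m0 := cmass_ge0 mu; have C0 := C1norm_ge0 phi.
pose K := d%:R * C1norm phi * (cmass mu *+ 2) + 1.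
have K0 : 0 < K by rewrite ltr_wpDl// !mulr_ge0// mulrn_wge0.
have [r r0 hr] := C1c_radius phi.
have eK : 0 < e / K by rewrite divr_gt0.
have := frozen_field_near cf r u eK; apply: filterS => v hv.
have cfv w := @frozen_field_continuous _ _ _ _ f_lip w.
rewrite (minus_divergenceE mu v) (minus_divergenceE mu u) /field_pairing.
have b w := cbmeas_grad_dot phi (cfv w).
have := cintegral_lin mu (-1) (b u) (b v); rewrite mulN1r addrC => <-.
apply: (@le_lt_trans _ _ (d%:R * C1norm phi * (e / K) * (cmass mu *+ 2))).
  apply: le_cintegral; first exact: cbmeas_lin.
  move=> x; rewrite mulN1r addrC -grad_dotB.
  have [xr|xr] := leP `|x| r.
    by rewrite (le_trans (le_grad_dot _ _ _))// ler_wpM2l ?mulr_ge0// ltW// hv.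
  rewrite /grad_dot big1 ?Normc.normc0; last by move=> j _; rewrite (hr x xr).2 mul0r.
  by rewrite mulr_ge0 ?(ltW eK)// mulr_ge0.
rewrite mulrAC mulrA ltr_pdivrMr// mulrC ltr_pM2l//.
by rewrite /K ltrDl.
Qed.

(** The functional is affine in the field, so convexity of the set of fields
    is inherited by the set of functionals. *)
Lemma minus_divergence_convex mu : convex_set (controlled_fields f) -> forall u v (t
  : R),
  0 <= t -> t <= 1 -> exists w, forall phi,
  minus_divergence mu w phi =
    t%:C * minus_divergence mu u phi + (1 - t)%:C * minus_divergence mu v phi.
Proof.
move=> /convex_setP cF u v t t0 t1.
have [w _ wE] := cF _ _ t t0 t1 (ex_intro2 _ _ u I erefl) (ex_intro2 _ _ v I erefl).
exists w => phi.
rewrite (minus_divergenceE mu w) (minus_divergenceE mu u) (minus_divergenceE mu v)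
  /field_pairing.
have cfv w := @frozen_field_continuous _ _ _ _ f_lip w.
have b w := cbmeas_grad_dot phi (cfv w).
have -> : grad_dot phi (frozen_field f w) = fun x => t%:C * grad_dot phi
  (frozen_field f u) x +
    (- t%:C * grad_dot phi (frozen_field f v) x + grad_dot phi (frozen_field f v) x).
  apply/funext => x; rewrite /grad_dot !mulr_sumr -!big_split/=; apply: eq_bigr => j _.
  rewrite (_ : frozen_field f w x 0 j = (t *: frozen_field f u x + (1 - t) *:
    frozen_field f v x) 0 j); last first.
    by rewrite wE.
  rewrite !mxE rmorphD !rmorphM rmorphB rmorph1.
  by rewrite mulrDr mulrCA; congr (_ + _);
    rewrite mulrBl mul1r mulrBr mulrCA mulNr addrC.
rewrite (cintegral_lin mu _ (b u) (cbmeas_lin _ (b v) (b v))) (cintegral_lin mu _ (b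
  v) (b v)).
by congr (_ + _); rewrite rmorphB rmorph1 mulrBl mul1r mulNr addrC.
Qed.

Lemma is_C0c_grad_dot phi u : is_C0c (grad_dot phi (frozen_field f u)).
Proof.
have cfu := @frozen_field_continuous _ _ _ _ f_lip u.
have [cr ci] := grad_dot_continuous phi cfu; split; last first.
  have /C1cP[_ _ _ cz] := C1c_funP phi.
  apply: subclosed_compact cz _; first exact: closed_closure.
  rewrite [X in _ `<=` X]((closure_id _).1 (@closed_closure _ _)).
  apply: closureS => x /= px; apply: contrapT => nx.
  by rewrite /grad_dot big1 ?eqxx// in px => j _; rewrite partial_support ?mul0r.
move=> x; apply/(@cvgrPdist_lt _ _ _ (nbhs x)) => e e0.
have eR : e = (Re e)%:C by case: e e0 => a b; rewrite ltcE /= => /andP[/eqP ->].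
have e2 : 0 < Re e / 2 by rewrite divr_gt0//; move: e0; rewrite eR ltcR.
have /(@cvgrPdist_lt _ _ _ (nbhs x))/(_ _ e2) hr := cr x.
have /(@cvgrPdist_lt _ _ _ (nbhs x))/(_ _ e2) hi := ci x.
apply: filterS (filterI hr hi) => y [/= h1 h2].
rewrite eR normc_def ltcR.
set z := grad_dot _ _ x - grad_dot _ _ y.
have -> : Num.sqrt (Re z ^+ 2 + Im z ^+ 2) = normc z by case: z.
rewrite (le_lt_trans (normc_le_ReIm _))// (splitr (Re e)) ltrD//.
  by move: h1; rewrite /z; case: (grad_dot _ _ x) (grad_dot _ _ y) => [? ?] [].
by move: h2; rewrite /z; case: (grad_dot _ _ x) (grad_dot _ _ y) => [? ?] [].
Qed.

(** The pairing of mu with an element of the Liouville operator is the value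
    of a functional - div (f_u mu); hence the adjoint is the set of
    functionals below the support function of the family. *)
Lemma liouville_adjointP mu (nu : E) : liouville_adjoint f mu nu <->
  forall phi, ((Re (nu phi))%:E <=
    ereal_sup [set (Re (minus_divergence mu u phi))%:E | u in setT])%E.
Proof.
have H phi : [set (Re (cintegral mu psi))%:E | psi in liouville f phi] =
    [set (Re (minus_divergence mu u phi))%:E | u in setT].
  apply/seteqP; split=> [_ [psi [u psiE] <-]|_ [u _ <-]].
    by exists u => //; rewrite minus_divergenceE /field_pairing -psiE.
  exists (MkC0c (is_C0c_grad_dot phi u)); first by exists u.
  by rewrite minus_divergenceE.
by split=> h phi; have := h phi; rewrite H.
Qed.

Lemma minus_divergence_adjoint mu u : liouville_adjoint f mu (minus_divergence mu u).
Proof. by apply/liouville_adjointP => phi; apply: ereal_sup_ubound; exists u. Qed.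

End Transport.
#[global] Opaque minus_divergence.

(** * Inner and outer limits of the difference quotients *)

Section Limits.
Context {R : realType} {d : nat} {U : metricType R}.
Local Notation V := 'rV[R]_d.
Local Notation D := (C1c R d).
Local Notation E := (C1c_dual R d).
Context {f : V * U -> V} {T tau : R} (T_gt0 : 0 < T) (tau0 : tau \in `[0, T])
  (cf : continuous f) (cU : compact [set: U])
  (f_growth : sublinear_growth f) (f_lip : locally_lipschitz f).
Implicit Types (mu nu : cmeasure R d).

Lemma difference_quotientE mu nu t (phi : D) :
  (((t - tau)^-1)%:C *: (measure_functional nu - measure_functional mu) : E) phi =
  ((t - tau)^-1)%:C * (cintegral nu phi - cintegral mu phi).
Proof. by rewrite dual_scaleE dual_addE dual_oppE !measure_functionalE. Qed.

Lemma constant_control_partition r eta u : 0 <= eta ->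
  control_partition f T r eta (fun=> u) (fun _ : 'I_1 => u) (fun _ _ => 1).
Proof.
move=> eta0; split=> //.
- by move=> k; apply: integrable_lebR; exact: cst_continuous.
- by move=> s _; rewrite big_ord1.
- by move=> k s x _ _ _; rewrite subrr normr0.
Qed.

(** For a constant control the averaged field is the field itself, so the
    quotients along its flow converge to the corresponding functional. *)
Lemma liminf_minus_divergences mu :
  minus_divergences f mu `<=` KP_liminf T tau (difference_quotient f T tau mu).
Proof.
rewrite minus_divergencesE => _ [u _ <-] N /nbhs_basic_nbhs[s [e [e0 sN]]].
have e2 : 0 < e / 2 by rewrite divr_gt0.
have [r [eta [delta [eta0 delta0 H]]]] := quotient_estimate_seq tau0 f_growth f_lip
  mu s e2.
exists delta => // t t0 /andP[tt td].
have tt' : t != tau by rewrite -subr_eq0 -normr_gt0.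
have [Phi flow] := constant_control_flow f_growth f_lip T u.
have [cPhi _] := flow tau t tau0 t0.
have [nu push] := pushforward_exists mu cPhi.
exists (((t - tau)^-1)%:C *: (measure_functional nu - measure_functional mu)); split.
  exists nu => //; exists (fun=> u); first exact: constant_control.
  by exists Phi.
apply: sN => phi phis.
have part := constant_control_partition r u (ltW eta0).
have := H t t0 tt' td (fun=> u) Phi 1%N _ _ nu flow part push phi phis.
rewrite big_ord1; have := sum_weight tau0 t0 tt' part; rewrite big_ord1 => ->.
rewrite difference_quotientE mul1r -(minus_divergenceE f_lip) => /le_lt_trans; apply.
by rewrite ltr_pdivrMr// ltr_pMr// ltr1n.
Qed.

(** Along any control, the quotient is close to a convex combination of
    functionals of constant controls. *)
Lemma limsup_closed_convex_hull mu :
  KP_limsup T tau (difference_quotient f T tau mu) `<=`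
  closed_convex_hull (minus_divergences f mu).
Proof.
move=> l hl N /nbhs_basic_nbhs[s [e [e0 sN]]].
have e2 : 0 < e / 2 by rewrite divr_gt0.
have [r [eta [delta [eta0 delta0 H]]]] := quotient_estimate_seq tau0 f_growth f_lip
  mu s e2.
have [t [t0 /andP[tt td] [_ [[nu [u cu [Phi flow push]] <-] lb]]]] :=
  hl _ (basic_nbhs_nbhs l s e2) delta delta0.
have tt' : t != tau by rewrite -subr_eq0 -normr_gt0.
have [n [p [chi part]]] := control_partition_exists cf cU r eta0 cu.
exists (\sum_k (weight tau t (chi k))%:C *: minus_divergence (f := f) mu (p k)); split.
  move=> C [cC SC]; apply: convex_sum => //.
  - move=> k; rewrite -[0]/((0 : R)%:C) lecR; apply: oriented_average_ge0.
    case: part => _ chi0 _ _ q bq; apply: chi0; exact: between_in bq.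
  - by rewrite -rmorph_sum (sum_weight tau0 t0 tt' part).
  - by move=> k; apply: SC; rewrite minus_divergencesE; exists (p k).
apply: sN => phi phis; have h1 := lb phi phis.
have := H t t0 tt' td u Phi n p chi nu flow part push phi phis.
rewrite difference_quotientE in h1.
rewrite dual_sumE; under [X in _ -> normc (X - _) < _]eq_bigr do
  rewrite dual_scaleE (minus_divergenceE f_lip).
move=> h2; set q := _ * _ in h1 h2; set S := \sum_k _ in h2 *.
rewrite -(subrKA q) (le_lt_trans (le_normcD _ _))// [e]splitr ler_ltD//.
by rewrite -opprB normcN.
Qed.

(** Since T > 0, there are times of [0, T] different from tau and arbitrarily
    close to it, on one side at least. *)
Lemma liminf_limsup (K : R -> set E) : KP_liminf T tau K `<=` KP_limsup T tau K.
Proof.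
move=> l hl N nN delta delta0; have [del' del'0 h] := hl N nN.
(* A distance c of at most T / 2 leaves room for tau + c or for tau - c in [0,
   T]. *)
pose c := Num.min (Num.min delta del' / 2) (T / 2).
have c0 : 0 < c by rewrite !lt_min !divr_gt0// lt_min delta0.
have [cd cT] : c <= Num.min delta del' / 2 /\ c <= T / 2.
  by rewrite /c !ge_min !lexx orbT.
have [t [t0 tc]] : exists t, t \in `[0, T] /\ `|t - tau| = c.
  have := tau0; rewrite in_itv/= => /andP[tau_ge tau_le].
  have [h2|h2] := leP tau (T / 2).
    exists (tau + c); rewrite (_ : tau + c - tau = c); last by ring.
    rewrite ger0_norm ?(ltW c0)//; split=> //.
    by rewrite in_itv/=; apply/andP; split; lra.
  exists (tau - c); rewrite (_ : tau - c - tau = - c); last by ring.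
  rewrite normrN ger0_norm ?(ltW c0)//; split=> //.
  by rewrite in_itv/=; apply/andP; split; lra.
have m0 : 0 < Num.min delta del' by rewrite lt_min delta0.
have : c < Num.min delta del'.
  by rewrite (le_lt_trans cd)// ltr_pdivrMr// ltr_pMr// ltr1n.
rewrite lt_min => /andP[c1 c2].
exists t; split=> //; first by rewrite tc c0.
by apply: h => //; rewrite tc c0.
Qed.

(** The set of functionals is convex, and closed by compactness of the set of
    controls. *)
Lemma hull_minus_divergences mu : convex_set (controlled_fields f) ->
  closed_convex_hull (minus_divergences f mu) `<=` minus_divergences f mu.
Proof.
rewrite minus_divergencesE => cF l hl.
suff [u ->] : exists u, l = minus_divergence (f := f) mu u by exists u.
apply: (range_of_approx cU (minus_divergence_near cf f_lip mu)) => s e e0.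
have [l' [l'hull l'b]] := hl _ (basic_nbhs_nbhs l s e0).
have [u _ uE] : range (minus_divergence (f := f) mu) l'.
  apply: l'hull; split=> //; apply/convex_setP => _ _ t t0 t1 [u _ <-] [v _ <-].
  have tR : t = (Re t)%:C by case: t t0 {t1} => a b; rewrite lecE /= => /andP[/eqP ->].
  have [r0 r1] : 0 <= Re t /\ Re t <= 1 by move: t0 t1;
    rewrite tR -[0]/((0:R)%:C) -[1]/((1:R)%:C) !lecR.
  have [w wE] := minus_divergence_convex f_lip mu cF u v r0 r1.
  exists w => //; apply: dual_ext => phi.
  have tB : (1 - Re t)%:C = 1 - t by rewrite {2}tR rmorphB rmorph1.
  by rewrite -/(minus_divergence mu w) wE dual_addE !dual_scaleE tB -tR.
by exists u => phi phis; rewrite uE; exact: l'b.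
Qed.

Lemma adjoint_minus_divergences mu : convex_set (controlled_fields f) ->
  liouville_adjoint f mu = minus_divergences f mu.
Proof.
rewrite minus_divergencesE => cF; apply/seteqP; split=> [l hl|_ [u _ <-]].
  have near_mu := minus_divergence_near cf f_lip mu.
  have [u ->] := range_of_approx cU near_mu (support_approx cU near_mu
    (minus_divergence_convex f_lip mu cF) ((liouville_adjointP f_lip mu l).1 hl)).
  by exists u.
exact: (minus_divergence_adjoint f_lip).
Qed.

End Limits.

Theorem theorem4p11 (R : realType) (d : nat) (U : metricType R)
  (f : 'rV[R]_d * U -> 'rV[R]_d) (T tau : R)
  (T_gt0 : 0 < T) (tau_in : tau \in `[0, T])
  (cU : compact [set: U]) (cf : continuous f)
  (f_growth : sublinear_growth f) (f_lip : locally_lipschitz f) :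
  (forall mu : cmeasure R d,
     minus_divergences f mu `<=`
       KP_liminf T tau (difference_quotient f T tau mu) /\
     KP_limsup T tau (difference_quotient f T tau mu) `<=`
       closed_convex_hull (minus_divergences f mu)) /\
  (convex_set (controlled_fields f) ->
   forall mu : cmeasure R d,
     KP_lim_is T tau (difference_quotient f T tau mu) (liouville_adjoint f mu)).
Proof.
have lo mu := liminf_minus_divergences tau_in f_growth f_lip mu.
have hi mu := limsup_closed_convex_hull tau_in cf cU f_growth f_lip mu.
split=> [mu|cF mu]; first by split; [exact: lo|exact: hi].
have mid := liminf_limsup T_gt0 tau_in (K := difference_quotient f T tau mu).
have hull := hull_minus_divergences cf cU f_lip (mu := mu) cF.
rewrite /KP_lim_is (adjoint_minus_divergences cf cU f_lip mu cF); split;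
  apply/seteqP; split.
- by move=> l /mid /hi /hull.
- exact: lo.
- by move=> l /hi /hull.
- by move=> l /lo /mid.
Qed.
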